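(* For a log-concave function $f$, let $b_0=-T_0^{-1}a_0$ denote the center of its Löwner function $L(f)(x)=e^{-\|T_0x+a_0\|_2+t_0}$. It is not true in general that $(L(f))^{b_0}=J(f^{b_0})$, nor that $L(f^{b_0})=(J(f))^{b_0}$. There is a one-dimensional counterexample, and higher-dimensional counterexamples are constructed accordingly. The one-dimensional example is $f=e^{-\psi}$ on $\mathbb{R}$ with $\psi(x)=4x^2$ for $x\le 0$ and $\psi(x)=x^2$ for $x>0$. For it, $$L(f)(x)=e^{-\frac{4}{\sqrt5}\left|x-\frac{3}{8\sqrt5}\right|+\frac12},\qquad b_0=\frac{3}{8\sqrt5},\qquad (L(f))^{b_0}=e^{-\frac12}\,\mathbf{1}_{\left[-\frac{4}{\sqrt5},\frac{4}{\sqrt5}\right]+\frac{3}{8\sqrt5}},$$ and $(L(f))^{b_0}\neq J(f^{b_0})$.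
   Context: A log-concave function on $\mathbb{R}^n$ is $f=e^{-\psi}$ with $\psi:\mathbb{R}^n\to\mathbb{R}\cup\{\infty\}$ convex; all log-concave functions considered are integrable and nondegenerate, i.e. $\mathrm{int}(\mathrm{supp} f)\neq\emptyset$. $\|\cdot\|_2$ is the Euclidean norm, $B_2^n$ the closed Euclidean unit ball, $\mathbf{1}_E$ the characteristic function of $E$, and $\mathcal{A}$ the set of invertible affine maps $A=T+a$ of $\mathbb{R}^n$ ($T\in GL(n)$, $a\in\mathbb{R}^n$), with $\det A=\det T$. Polar: for $z\in\mathbb{R}^n$, the polar of $f=e^{-\psi}$ with respect to $z$ is $$f^z(y)=\inf_{x\in\mathrm{supp}(f)}\frac{e^{-\langle x-z,y-z\rangle}}{f(x)}=e^{-\mathcal{L}_z\psi(y)},\qquad \mathcal{L}_z\psi(y)=\sup_{x\in\mathbb{R}^n}[\langle x-z,y-z\rangle-\psi(x)].$$ Löwner function: $L(f)(x)=e^{-\|A_0x\|_2+t_0}$, where $(A_0,t_0)$ minimizes $\int_{\mathbb{R}^n}e^{-\|Ax\|_2+t}\,dx$ over all $A\in\mathcal{A}$, $t\in\mathbb{R}$ subject to $\|Ax\|_2-t\le\psi(x)$ for all $x\in\mathbb{R}^n$. The minimizer exists, $t_0$ is unique and $A_0$ is unique up to left orthogonal transformations, so one may write $A_0x=T_0x+a_0$ with $T_0$ symmetric positive definite and $a_0\in\mathbb{R}^n$. John function: $J(f)=s_0\mathbf{1}_{A_0B_2^n}$, where $(s_0,A_0)$ maximizes $s\,|\det A|$ over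 all $s\le\|f\|_\infty$ and $A\in\mathcal{A}$ subject to $s\mathbf{1}_{AB_2^n}\le f$; here $A_0$ is unique up to right orthogonal transformations. *)

(* Defs.v *)
From HB Require Import structures.
From mathcomp Require Import all_boot all_order all_algebra.
From mathcomp Require Import all_classical all_reals all_analysis.

Set Implicit Arguments.
Unset Strict Implicit.
Unset Printing Implicit Defensive.

Import Order.TTheory GRing.Theory Num.Theory.
Import numFieldNormedType.Exports.

Local Open Scope classical_set_scope.
Local Open Scope ring_scope.

(** * Lebesgue measure on R^n

    The library has no measure on column vectors.  We use the n-fold product
    [R * (R * (... * unit))] with the product sigma-algebra and the product of
    the one-dimensional Lebesgue measures, and identify it with ['cV[R]_n]
    through the coordinate bijection [vec_of_prod]. *)

Section ProductSigmaFinite.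
Local Open Scope ereal_scope.
Context {d1 d2} {T1 : measurableType d1} {T2 : measurableType d2} {R : realType}.
Variables (m1 : {sigma_finite_measure set T1 -> \bar R})
          (m2 : {sigma_finite_measure set T2 -> \bar R}).

(* The library shows that [m1 \x m2] is sigma-finite, but canonical structure
   inference only finds its later instance for subprobabilities; hence this
   alias. *)
Definition product_sigma_finite : set (T1 * T2) -> \bar R := m1 \x m2.

HB.instance Definition _ := Measure.copy product_sigma_finite (m1 \x m2).

Let product_sigma_finiteT : sigma_finite setT product_sigma_finite.
Proof.
have /sigma_finiteP[F [TF ndF Foo]] := sigma_finiteT m1.
have /sigma_finiteP[G [TG ndG Goo]] := sigma_finiteT m2.
exists (fun n => F n `*` G n).
  rewrite -setXTT TF TG predeqE => -[x y]; split.
    move=> [/= [n _ Fnx] [k _ Gky]]; exists (maxn n k) => //; split.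
    - by move: x Fnx; exact/subsetPset/ndF/leq_maxl.
    - by move: y Gky; exact/subsetPset/ndG/leq_maxr.
  by move=> [n _ []/= ? ?]; split; exists n.
move=> k; have [? ?] := Foo k; have [? ?] := Goo k.
split; first exact: measurableX.
by rewrite /product_sigma_finite product_measure1E// lte_mul_pinfty//
  ge0_fin_numE.
Qed.

HB.instance Definition _ := Measure_isSigmaFinite.Build _ _ _
  product_sigma_finite product_sigma_finiteT.

End ProductSigmaFinite.

Section Lebesgue.
Context {R : realType}.

Fixpoint prod_display (n : nat) : measure_display :=
  if n is m.+1
  then measure_prod_display ((R.-ocitv.-measurable).-sigma%mdisp, prod_display m)
  else default_measure_display.

Fixpoint prod_space (n : nat) : measurableType (prod_display n) :=
  match n return measurableType (prod_display n) with
  | 0%N => unit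
  | m.+1 => (measurableTypeR R * prod_space m)%type
  end.

Fixpoint lebesgue_prod (n : nat) :
    {sigma_finite_measure set (prod_space n) -> \bar R} :=
  match n return {sigma_finite_measure set (prod_space n) -> \bar R} with
  | 0%N => dirac tt
  | m.+1 => product_sigma_finite (@lebesgue_measure R) (lebesgue_prod m)
  end.

Fixpoint vec_of_prod (n : nat) : prod_space n -> 'cV[R]_n :=
  match n return prod_space n -> 'cV[R]_n with
  | 0%N => fun=> 0
  | m.+1 => fun u => col_mx (u.1%:M : 'cV_1) (vec_of_prod u.2)
  end.

(* For a nonnegative [f] that is not Borel the library's integral is the supremum
   over Borel simple functions below [f]; it is the Lebesgue integral of [f] as
   soon as [f] is Lebesgue measurable, which every log-concave function is. *)
Definition integral_Rn (n : nat) (f : 'cV[R]_n -> R) : \bar R :=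
  (\int[lebesgue_prod n]_u (f (vec_of_prod u))%:E)%E.

End Lebesgue.

(** * Log-concave functions and polarity *)

Section Functions.
Context {R : realType} {n : nat}.
Implicit Types (f g : 'cV[R]_n -> R) (x y z : 'cV[R]_n) (T : 'M[R]_n).

Definition dot x y : R := \sum_i x i 0 * y i 0.

(* The library norm on matrices is the sup norm. *)
Definition norm2 x : R := Num.sqrt (dot x x).

(* Convex functions R^n -> R U {+oo}; recall that 0 * +oo = 0 in [\bar R]. *)
Definition convex_ext (psi : 'cV[R]_n -> \bar R) : Prop :=
  (forall x, psi x != -oo%E) /\
  (forall (l : R) x y, 0 <= l -> l <= 1 ->
    (psi (l *: x + (1 - l) *: y)%R <= l%:E * psi x + (1 - l)%:E * psi y)%E).

Definition log_concave f : Prop :=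
  exists2 psi, convex_ext psi & forall x, (f x)%:E = expeR (- psi x).

(* The function psi such that f = exp(-psi). *)
Definition potential f x : \bar R := (- lne (f x)%:E)%E.

Lemma potentialE f (psi : 'cV[R]_n -> \bar R) :
  (forall x, (f x)%:E = expeR (- psi x)) -> potential f = psi.
Proof.
by move=> fE; apply/funext => x; rewrite /potential fE expeRK oppeK.
Qed.

Definition supp f : set 'cV[R]_n := [set x | f x != 0].

Definition admissible f : Prop :=
  [/\ log_concave f, (integral_Rn f < +oo)%E & interior (supp f) !=set0].

Definition polar z f y : R :=
  inf [set expR (- dot (x - z) (y - z)) / f x | x in supp f].

Definition sup_norm f : \bar R := ereal_sup (range (fun x => `|f x|%:E)).

(** * Loewner and John functions

    An invertible affine map [A x = T *m x + a] is a pair [(T, a)] with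
    [T \in unitmx]. *)

Definition aff T (a x : 'cV[R]_n) : 'cV[R]_n := T *m x + a.

Definition unit_ball : set 'cV[R]_n := [set x | norm2 x <= 1].

Definition cone_fun T (a : 'cV[R]_n) (t : R) x : R :=
  expR (- norm2 (aff T a x) + t).

Definition loewner_feasible f T (a : 'cV[R]_n) (t : R) : Prop :=
  T \in unitmx /\ forall x, ((norm2 (aff T a x) - t)%:E <= potential f x)%E.

Definition loewner_optimal f T (a : 'cV[R]_n) (t : R) : Prop :=
  loewner_feasible f T a t /\
  forall T' a' t', loewner_feasible f T' a' t' ->
    (integral_Rn (cone_fun T a t) <= integral_Rn (cone_fun T' a' t'))%E.

Definition sym_posdef T : Prop :=
  T^T = T /\ forall x, x != 0 -> 0 < dot x (T *m x).

(* [is_loewner f g b]: g = L(f), with center b. *)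
Definition is_loewner f g (b : 'cV[R]_n) : Prop :=
  exists T a t, [/\ sym_posdef T, loewner_optimal f T a t,
    g = cone_fun T a t & b = - (invmx T *m a)].

Definition ball_fun (s : R) T (a : 'cV[R]_n) x : R :=
  s * \1_(aff T a @` unit_ball) x.

Definition john_feasible f (s : R) T (a : 'cV[R]_n) : Prop :=
  [/\ T \in unitmx, (s%:E <= sup_norm f)%E & forall x, ball_fun s T a x <= f x].

Definition john_optimal f (s : R) T (a : 'cV[R]_n) : Prop :=
  john_feasible f s T a /\
  forall s' T' a', john_feasible f s' T' a' ->
    s' * `|\det T'| <= s * `|\det T|.

(* [is_john f g]: g = J(f). *)
Definition is_john f g : Prop :=
  exists s T a, john_optimal f s T a /\ g = ball_fun s T a.

End Functions.

(** * The one-dimensional example *)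

Section Example.
Context {R : realType}.

Definition psi_ex (x : R) : R := if x <= 0 then 4 * x ^+ 2 else x ^+ 2.

Definition f_ex (x : 'cV[R]_1) : R := expR (- psi_ex (x 0 0)).

Definition center_ex : R := 3 / (8 * Num.sqrt 5).

Definition loewner_ex (x : 'cV[R]_1) : R :=
  expR (- (4 / Num.sqrt 5 * `|x 0 0 - center_ex|) + 1 / 2).

Definition polar_loewner_ex (y : 'cV[R]_1) : R :=
  expR (- (1 / 2)) *
  \1_[set y : 'cV[R]_1 | - (4 / Num.sqrt 5) + center_ex <= y 0 0
                         <= 4 / Num.sqrt 5 + center_ex] y.

End Example.

(* Main.v *)
Require Import Defs.
From HB Require Import structures.
From mathcomp Require Import all_boot all_order all_algebra.
From mathcomp Require Import all_classical all_reals all_analysis measurable_realfun.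
From mathcomp Require Import ring lra.

Set Implicit Arguments.
Unset Strict Implicit.
Unset Printing Implicit Defensive.

Import Order.TTheory GRing.Theory Num.Theory.
Import numFieldNormedType.Exports.

Local Open Scope classical_set_scope.
Local Open Scope ring_scope.

(** The integral of a cone function exp(-|Tx + a| + t) is at least e^t divided by
    the product of the norms of the columns of T, times a constant, with equality
    for diagonal T.  So a Loewner problem whose constraints bound the columns of T
    one by one is solved by a diagonal matrix.  Dually, Hadamard's inequality bounds
    |det T| by the norms of the rows, which solves the John problem of a cylinder.

    Write x = (x_0, x') and let h be the support function of [-1, 3].
    For f(x) = exp(-h(x_0) - |x'|) one finds L(f) = exp(-|x|), with center 0, but
    f^0 is the indicator of [-1, 3] x B, whose John ellipsoid has center (1, 0).
    For f(x) = exp(-h(x_0)) on the cylinder |x'| <= 1, the center of L(f) is 0, and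
    J(f) is supported on an ellipsoid with center (-1/3, 0); its polar at 0 has the
    value e at 0, where L(f^0) has the value sqrt e.

    In dimension one, the endpoints of the interval of (L f)^b can be moved so that
    the product of height and length grows, hence (L f)^b is not J(f^b).  The polar
    at b of the indicator of an interval is a cone function only if b is the
    midpoint, which is not the case for J(f). *)

(** * Affine changes of variables *)

(** The function h grows with slope 1 to the left and slope 3 to the right. A cone grows equally
    fast in opposite directions, so a cone dominating exp(-h) only feels the smaller slope, and its
    optimal center stays at 0; the polar at 0 sees both slopes and is centered at 1. Adding |x'| or
    restricting to a cylinder carries this one-dimensional asymmetry into every dimension.
    Competitors in the Loewner problem are arbitrary invertible matrices. Each constraint is tested
    on a ray or on two points of the support, which bounds one column whatever the translation is.
    What remains is to minimize e^t divided by a power of t or by a slope tau; this always follows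
    from 1 + x <= e^x. The mass of exp(-|x|) is never evaluated: it is a common factor. For the
    explicit f, the Loewner function is shown to be unique by turning the optimality inequality into
    a vanishing square, and J(f) is treated in the same way. L(f^b) is written with a root of a
    quadratic equation, while J(f^b) is obtained by compactness, without a formula. *)

Section IntegralAffine.
Context {R : realType}.
Notation mu := (@lebesgue_measure R).

(** The pushforward of [mu] under x |-> d x + c, scaled by |d|, agrees with [mu] on half-open
    intervals, hence everywhere. *)
Lemma ge0_integral_affine (d c : R) (g : measurableTypeR R -> \bar R) : d != 0 ->
  measurable_fun setT g -> (forall x, (0 <= g x)%E) ->
  (\int[mu]_x g (d * x + c)%R = `|d|^-1%:E * \int[mu]_x g x)%E.
Proof.
move=> d0 mg g0.
have ad : 0 < `|d| by rewrite normr_gt0.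
pose phi : measurableTypeR R -> measurableTypeR R := fun x => d * x + c.
have mphi : measurable_fun setT phi.
  by apply: measurable_funD => //; exact: measurable_funM.
have phiE (a b : R) : mu (phi @^-1` `]a, b]%classic) = (`|d|^-1%:E * mu `]a, b]%classic)%E.
  have [dgt|dlt|] := ltgtP 0 d; last by move/esym/eqP; rewrite (negbTE d0).
    rewrite (_ : phi @^-1` _ = `](a - c) / d, (b - c) / d]%classic); last first.
      apply/seteqP; split => x /=; rewrite !in_itv/= ltr_pdivrMr// ler_pdivlMr// /phi;
      rewrite ltrBlDr lerBrDr (mulrC x)//.
    rewrite !lebesgue_measure_itv/= !lte_fin ltr_pM2r ?invr_gt0// ltrD2r.
    case: ifPn => _; last by rewrite mule0.
    by rewrite -!EFinB -EFinM gtr0_norm//; congr EFin; field.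
  (* A negative [d] reverses the interval, so its closed end moves to the left; the length is the
     same. *)
  rewrite (_ : phi @^-1` _ = `[(b - c) / d, (a - c) / d[%classic); last first.
    apply/seteqP; split => x /=; rewrite !in_itv/= ltr_ndivlMr// ler_ndivrMr// /phi;
    by rewrite ltrBlDr lerBrDr (mulrC x) andbC.
  rewrite !lebesgue_measure_itv/= !lte_fin ltr_nM2r ?invr_lt0// ltrD2r.
  case: ifPn => _; last by rewrite mule0.
  by rewrite -!EFinB -EFinM ltr0_norm//; congr EFin; field.
have ad0 : 0 <= `|d| by exact: ltW.
pose nu : {measure set (measurableTypeR R) -> \bar R} :=
  measure_function_pushforward__canonical__measure_function_Measure mu mphi.
have -> : (\int[mu]_x g x = \int[mscale (NngNum ad0) nu]_x g x)%E.
  apply: eq_measure_integral => A mA _; apply: lebesgue_measure_unique => // _ [[a b]] _ <-.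
  by rewrite /= /mscale/= /pushforward (phiE a b) muleA -EFinM mulfV ?mul1e ?gt_eqF.
rewrite ge0_integral_mscale//= ge0_integral_pushforward//=.
by rewrite preimage_setT muleA -EFinM mulVf ?mul1e ?gt_eqF.
Qed.

End IntegralAffine.

Section IntegralRn.
Context {R : realType}.
Notation mu := (@lebesgue_measure R).

Fixpoint prod_of_vec (n : nat) : 'cV[R]_n -> @prod_space R n :=
  match n return 'cV[R]_n -> @prod_space R n with
  | 0%N => fun=> tt
  | m.+1 => fun x => (x ord0 0, prod_of_vec (dsubmx (x : 'cV_(1 + m))))
  end.

Lemma prod_of_vecK n (x : 'cV[R]_n) : vec_of_prod (prod_of_vec x) = x.
Proof.
elim: n x => [|n IHn] x /=; first by apply/colP; case.
rewrite IHn; apply: etrans (vsubmxK (x : 'cV_(1 + n))).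
rewrite (_ : usubmx _ = (x ord0 0)%:M)//.
by apply/colP => i; rewrite !ord1 !mxE/= mulr1n; congr (x _ _); apply: val_inj.
Qed.

Lemma measurable_coord n (i : 'I_n) :
  measurable_fun setT (fun u : prod_space n => (vec_of_prod u : 'cV[R]_n) i 0).
Proof.
elim: n i => [[]//|n IHn] i /=.
have [->|[j ->]] : i = lshift n (0 : 'I_1) \/ exists j, i = rshift 1 j.
  by case: (splitP (i : 'I_(1 + n))) => j ij; [left|right; exists j]; apply: val_inj;
    rewrite /= ij ?ord1.
  under eq_fun do rewrite (@col_mxEu _ 1 n 1) mxE eqxx mulr1n.
  exact: measurable_fst.
under eq_fun do rewrite (@col_mxEd _ 1 n 1).
exact: measurableT_comp (IHn j) measurable_snd.
Qed.

(** Measurability on column vectors is read on the product space, where the measure lives. *)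
Definition measurable_vec n d (T : measurableType d) (g : 'cV[R]_n -> T) :=
  measurable_fun setT (g \o @vec_of_prod R n).

Lemma measurable_prod_of_vec d (T : measurableType d) n (h : T -> 'cV[R]_n) :
  (forall i, measurable_fun setT (fun t => h t i 0)) ->
  measurable_fun setT (@prod_of_vec n \o h).
Proof.
elim: n h => [|n IHn] h mh /=; first exact: measurable_cst.
apply/measurable_fun_pair => /=; first exact: mh.
apply: (IHn (fun t => dsubmx (h t : 'cV_(1 + n)))) => i.
by under eq_fun do rewrite mxE; exact: mh.
Qed.

Lemma measurable_vec_comp d d' (T : measurableType d) (S : measurableType d') n
    (g : 'cV[R]_n -> S) (h : T -> 'cV[R]_n) : measurable_vec g ->
  (forall i, measurable_fun setT (fun t => h t i 0)) ->
  measurable_fun setT (g \o h).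
Proof.
move=> mg /measurable_prod_of_vec mh.
rewrite (_ : g \o h = (g \o @vec_of_prod R n) \o (@prod_of_vec n \o h)).
  exact: measurableT_comp mg mh.
by apply/funext => t /=; rewrite prod_of_vecK.
Qed.

Lemma integral_RnS n (g : 'cV[R]_n.+1 -> R) : measurable_vec g ->
  (forall x, 0 <= g x) ->
  integral_Rn g =
  (\int[mu]_x integral_Rn (fun v : 'cV[R]_n => g (col_mx (x%:M : 'cV_1) v)))%E.
Proof.
move=> mg g0; rewrite /integral_Rn.
apply: (@fubini_tonelli1 _ _ _ _ R mu (lebesgue_prod n)
  (fun u => (g (@vec_of_prod R n.+1 u))%:E)) => [|u]; last by rewrite lee_fin.
exact/measurable_EFinP.
Qed.

Lemma measurable_integral_RnS n (g : 'cV[R]_n.+1 -> R) : measurable_vec g ->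
  (forall x, 0 <= g x) ->
  measurable_fun setT
    (fun x : R => integral_Rn (fun v : 'cV[R]_n => g (col_mx (x%:M : 'cV_1) v))).
Proof.
move=> mg g0; rewrite /integral_Rn.
apply: (@measurable_fun_fubini_tonelli_F _ _ _ _ R (lebesgue_prod n)
  (fun u => (g (@vec_of_prod R n.+1 u))%:E)) => [|u]; last by rewrite lee_fin.
exact/measurable_EFinP.
Qed.

Lemma integral_Rn_ge0 n (g : 'cV[R]_n -> R) :
  (forall x, 0 <= g x) -> (0 <= integral_Rn g)%E.
Proof. by move=> g0; apply: integral_ge0 => u _; rewrite lee_fin. Qed.

Lemma measurable_vec_section n (g : 'cV[R]_n.+1 -> R) (x : R) : measurable_vec g ->
  measurable_vec (fun v : 'cV[R]_n => g (col_mx (x%:M : 'cV_1) v)).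
Proof.
move=> mg; apply: (measurableT_comp mg (measurable_pair1 x)).
Qed.

(** A diagonal affine map acts on each coordinate separately, so Tonelli and the one-dimensional
    rule give the result by induction. Translations, sign changes and diagonal scalings are the
    changes of variables used below. *)
Lemma integral_Rn_affine n (d c : 'I_n -> R) (g : 'cV[R]_n -> R) :
  (forall i, d i != 0) -> measurable_vec g -> (forall x, 0 <= g x) ->
  integral_Rn (fun x => g (\col_i (d i * x i 0 + c i))) =
  ((\prod_i `|d i|)^-1%:E * integral_Rn g)%E.
Proof.
elim: n d c g => [|n IHn] d c g d0 mg g0.
  rewrite big_ord0 invr1 mul1e; apply: eq_integral => u _; congr (g _)%:E.
  by apply/colP; case.
rewrite [LHS]integral_RnS//; last first.
  apply: (measurable_vec_comp mg) => i; under eq_fun do rewrite mxE.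
  apply: measurable_funD => //; apply: measurable_funM => //.
  exact: measurable_coord.
rewrite [in RHS]integral_RnS//.
have mG := measurable_integral_RnS mg g0.
set G := fun x => integral_Rn _ in mG *.
have G0 x : (0 <= G x)%E by exact: integral_Rn_ge0.
transitivity (\int[mu]_x ((\prod_i `|d (lift ord0 i)|)^-1%:E
    * G (d ord0 * x + c ord0)%R))%E.
  apply: eq_integral => x _.
  rewrite -(IHn (fun i => d (lift ord0 i)) (fun i => c (lift ord0 i))
    (fun v => g (col_mx ((d ord0 * x + c ord0)%:M : 'cV_1) v)))//; last first.
    exact: measurable_vec_section.
  congr integral_Rn; apply/funext => v; congr g; apply/colP => i; rewrite mxE.
  case: (splitP (i : 'I_(1 + n))) => j ij.
    rewrite (_ : i = lshift n j) ?(@col_mxEu _ 1 n 1); last exact: val_inj.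
    rewrite !mxE !ord1/= !mulr1n.
    by congr (d _ * _ + c _); apply: val_inj.
  rewrite (_ : i = rshift 1 j) ?(@col_mxEd _ 1 n 1); last exact: val_inj.
  by rewrite !mxE; congr (d _ * _ + c _); apply: val_inj.
clearbody G; rewrite ge0_integralZl//; last 2 first.
- apply: (measurableT_comp mG).
  by apply: measurable_funD => //; exact: measurable_funM.
- by rewrite lee_fin invr_ge0 prodr_ge0.
by rewrite (ge0_integral_affine (c ord0) (d0 ord0) mG)// muleA -EFinM big_ord_recl
  invfM mulrC.
Qed.

End IntegralRn.

(** * Euclidean norm *)

Section Geometry.
Context {R : realType}.

Lemma dotC n (x y : 'cV[R]_n) : dot x y = dot y x.
Proof. by apply: eq_bigr => i _; rewrite mulrC. Qed.

Lemma dotDl n (x y z : 'cV[R]_n) : dot (x + y) z = dot x z + dot y z.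
Proof. by rewrite /dot -big_split; apply: eq_bigr => i _; rewrite !mxE mulrDl. Qed.

Lemma dotZl n a (x y : 'cV[R]_n) : dot (a *: x) y = a * dot x y.
Proof. by rewrite /dot mulr_sumr; apply: eq_bigr => i _; rewrite !mxE mulrA. Qed.

Lemma dotDr n (x y z : 'cV[R]_n) : dot z (x + y) = dot z x + dot z y.
Proof. by rewrite ![dot z _]dotC dotDl. Qed.

Lemma dotZr n a (x y : 'cV[R]_n) : dot y (a *: x) = a * dot y x.
Proof. by rewrite ![dot y _]dotC dotZl. Qed.

Lemma dot0l n (x : 'cV[R]_n) : dot 0 x = 0.
Proof. by rewrite -(scale0r 0) dotZl mul0r. Qed.

Lemma dot_ge0 n (x : 'cV[R]_n) : 0 <= dot x x.
Proof. by apply: sumr_ge0 => i _; rewrite -expr2 sqr_ge0. Qed.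

Lemma dot_eq0 n (x : 'cV[R]_n) : (dot x x == 0) = (x == 0).
Proof.
apply/idP/eqP => [|->]; last by rewrite dot0l.
rewrite psumr_eq0 => [/allP h|i _]; last by rewrite -expr2 sqr_ge0.
apply/colP => i; rewrite mxE; apply/eqP.
by have := h i (mem_index_enum i); rewrite /= -expr2 sqrf_eq0.
Qed.

Lemma norm2_ge0 n (x : 'cV[R]_n) : 0 <= norm2 x.
Proof. exact: sqrtr_ge0. Qed.

Lemma sqr_norm2 n (x : 'cV[R]_n) : norm2 x ^+ 2 = dot x x.
Proof. by rewrite sqr_sqrtr// dot_ge0. Qed.

Lemma norm2_eq0 n (x : 'cV[R]_n) : (norm2 x == 0) = (x == 0).
Proof. by rewrite -sqrf_eq0 sqr_norm2 dot_eq0. Qed.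

Lemma norm2_gt0 n (x : 'cV[R]_n) : (0 < norm2 x) = (x != 0).
Proof. by rewrite lt0r norm2_ge0 norm2_eq0 andbT. Qed.

Lemma norm2_0 n : norm2 (0 : 'cV[R]_n) = 0.
Proof. by apply/eqP; rewrite norm2_eq0. Qed.

Lemma norm2Z n a (x : 'cV[R]_n) : norm2 (a *: x) = `|a| * norm2 x.
Proof.
by rewrite /norm2 dotZl dotZr mulrA -expr2 sqrtrM ?sqr_ge0// sqrtr_sqr.
Qed.

Lemma norm2N n (x : 'cV[R]_n) : norm2 (- x) = norm2 x.
Proof. by rewrite -scaleN1r norm2Z normrN1 mul1r. Qed.

Lemma norm2_le n (x : 'cV[R]_n) r : 0 <= r -> (norm2 x <= r) = (dot x x <= r ^+ 2).
Proof. by move=> r0; rewrite -sqr_norm2 ler_pXn2r// nnegrE ?norm2_ge0. Qed.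

(** Cauchy-Schwarz: expand the nonnegative square of |y| x - |x| y, then divide by |x| |y|. *)
Lemma dot_le_norm2 n (x y : 'cV[R]_n) : dot x y <= norm2 x * norm2 y.
Proof.
have [->|y0] := eqVneq y 0; first by rewrite dotC dot0l norm2_0 mulr0.
have yp : 0 < norm2 y by rewrite norm2_gt0.
have := dot_ge0 (norm2 y *: x + (- norm2 x) *: y).
rewrite dotDl !dotDr !dotZl !dotZr (dotC y x) -!sqr_norm2.
have [->|x0] := eqVneq x 0; first by rewrite dot0l norm2_0 mul0r.
have xp : 0 < norm2 x by rewrite norm2_gt0.
have xyp := mulr_gt0 xp yp.
move: (dot x y) (norm2 x) (norm2 y) xyp => d a b ab h.
rewrite -(ler_pM2l ab); nra.
Qed.

Lemma norm2D n (x y : 'cV[R]_n) : norm2 (x + y) <= norm2 x + norm2 y.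
Proof.
rewrite norm2_le ?addr_ge0 ?norm2_ge0// dotDl !dotDr (dotC y x) -!sqr_norm2.
by have := dot_le_norm2 x y; nra.
Qed.

Lemma norm2_coord n (x : 'cV[R]_n) i : `|x i 0| <= norm2 x.
Proof.
rewrite -(ler_pXn2r (n := 2))// ?nnegrE ?norm2_ge0// sqr_norm2 real_normK ?num_real//.
rewrite /dot (bigD1 i)//= expr2 lerDl.
by apply: sumr_ge0 => j _; rewrite -expr2 sqr_ge0.
Qed.

Lemma measurable_norm2 d (T : measurableType d) n (h : T -> 'cV[R]_n) :
  (forall i, measurable_fun setT (fun t => h t i 0)) ->
  measurable_fun setT (fun t => norm2 (h t)).
Proof.
move=> mh; apply: (measurableT_comp (continuous_measurable_fun (@sqrt_continuous R))).
apply: measurable_sum => i; exact: measurable_funM.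
Qed.

Lemma measurable_mulmx d (T : measurableType d) m n (A : 'M[R]_(m, n)) (h : T -> 'cV[R]_n) :
  (forall i, measurable_fun setT (fun t => h t i 0)) ->
  forall i, measurable_fun setT (fun t => (A *m h t) i 0).
Proof.
move=> mh i; under eq_fun do rewrite mxE.
by apply: measurable_sum => j; exact: measurable_funM.
Qed.

Lemma cone_fun_gt0 n (A : 'M[R]_n) a t x : 0 < cone_fun A a t x.
Proof. exact: expR_gt0. Qed.

End Geometry.

(** * Integrals of cone functions *)

Section SignAverage.
Context {R : realType}.

(* Jensen's inequality for exp and the square, via the tangent at N. *)
Lemma sum_expRN_ge (I : finType) (y : I -> R) (N : R) : 0 <= N ->
  (forall i, 0 <= y i) -> \sum_i y i ^+ 2 = #|I|%:R * N ^+ 2 ->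
  #|I|%:R * expR (- N) <= \sum_i expR (- y i).
Proof.
move=> N0 y0 yN; have [N_eq0|N_neq0] := eqVneq N 0.
  rewrite (eq_bigr (fun=> expR (- N))) => [|i _].
    by rewrite sumr_const mulr_natl.
  move: yN; rewrite N_eq0 expr0n mulr0 => /eqP.
  rewrite psumr_eq0 => [/allP/(_ i (mem_index_enum i))/=|j _]; last exact: sqr_ge0.
  by rewrite sqrf_eq0 => /eqP->.
have Np : 0 < N by rewrite lt0r N_neq0.
apply: le_trans (_ : \sum_i expR (- N) * (1 + (N ^+ 2 - y i ^+ 2) / (2 * N)) <= _).
  rewrite -mulr_sumr big_split/= -mulr_suml sumrB yN !sumr_const.
  by rewrite -(mulr_natl (N ^+ 2)) subrr mul0r addr0 mulrC.
apply: ler_sum => i _.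
rewrite (_ : - y i = - N + (N - y i)); last by ring.
rewrite expRD ler_pM2l ?expR_gt0//; apply: le_trans (expR_ge1Dx _).
rewrite lerD2l ler_pdivrMr ?mulr_gt0//.
by have := sqr_ge0 (N - y i); nra.
Qed.

Definition flip n (s : {ffun 'I_n -> bool}) (x : 'cV[R]_n) : 'cV[R]_n :=
  \col_i ((-1) ^+ s i * x i 0).

(** For i != j, flipping the i-th sign is an involution of the sign vectors that negates each term,
    so the sum equals its own opposite. *)
Lemma sum_signM n (i j : 'I_n) :
  \sum_(s : {ffun 'I_n -> bool}) (-1) ^+ s i * (-1) ^+ s j
  = (i == j)%:R * #|{ffun 'I_n -> bool}|%:R :> R.
Proof.
have [->|ij] := eqVneq i j.
  rewrite mul1r (eq_bigr (fun=> 1)) => [|s _]; first by rewrite sumr_const.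
  by rewrite -expr2 sqrr_sign.
rewrite mul0r; set S := LHS.
pose h (s : {ffun 'I_n -> bool}) := [ffun k => s k (+) (k == i)].
have hK : involutive h by move=> s; apply/ffunP => k; rewrite !ffunE addbK.
suff : S = - S by move=> /eqP; rewrite -addr_eq0 -mulr2n mulrn_eq0 => /eqP.
rewrite {1}/S (reindex_inj (inv_inj hK)) -sumrN; apply: eq_bigr => s _.
by rewrite !ffunE eqxx eq_sym (negbTE ij) addbF addbT signrN mulNr.
Qed.

(** The cross terms between different columns cancel on averaging over signs; only the squared
    column norms survive. *)
Lemma sum_sqr_norm2_flip n (T : 'M[R]_n) x :
  \sum_(s : {ffun 'I_n -> bool}) norm2 (T *m flip s x) ^+ 2 =
  #|{ffun 'I_n -> bool}|%:R * norm2 (\col_i (norm2 (col i T) * x i 0)) ^+ 2.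
Proof.
transitivity (\sum_(s : {ffun 'I_n -> bool}) \sum_k \sum_i \sum_j
    (T k i * x i 0) * (T k j * x j 0) * ((-1) ^+ s i * (-1) ^+ s j)).
  apply: eq_bigr => s _; rewrite sqr_norm2; apply: eq_bigr => k _.
  rewrite !mxE big_distrlr/=; apply: eq_bigr => i _; apply: eq_bigr => j _.
  by rewrite !mxE; ring.
rewrite exchange_big/= sqr_norm2 /dot mulr_sumr.
under [RHS]eq_bigr => i _ do rewrite !mxE mulrACA -expr2 sqr_norm2 -expr2 /dot
  mulrCA mulr_suml.
rewrite [RHS]exchange_big/=; apply: eq_bigr => k _.
rewrite exchange_big/=; apply: eq_bigr => i _.
rewrite exchange_big/= (bigD1 i)//= -mulr_sumr sum_signM eqxx mul1r.
rewrite [X in _ + X]big1 => [|j ji]; last first.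
  by rewrite -mulr_sumr sum_signM eq_sym (negbTE ji) mul0r mulr0.
by rewrite !mxE addr0; ring.
Qed.

End SignAverage.

Section ConeIntegral.
Context {R : realType}.

Definition cone_mass n : \bar R := integral_Rn (fun x : 'cV[R]_n => expR (- norm2 x)).

Lemma cone_mass_ge0 n : (0 <= cone_mass n)%E.
Proof. by apply: integral_Rn_ge0 => x; exact: expR_ge0. Qed.

Lemma measurable_cone_vec n : measurable_vec (fun x : 'cV[R]_n => expR (- norm2 x)).
Proof.
apply: measurableT_comp => //; apply: measurableT_comp => //.
by apply: measurable_norm2 => i; exact: measurable_coord.
Qed.

(** No measurability is assumed: the integral of a nonnegative function is a supremum over simple
    functions below it. This bounds the integrals of the examples by those of cones. *)
Lemma le_integral_Rn n (f g : 'cV[R]_n -> R) : (forall x, 0 <= f x) ->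
  (forall x, f x <= g x) -> (integral_Rn f <= integral_Rn g)%E.
Proof.
move=> f0 fg; rewrite /integral_Rn !ge0_integralTE; last 2 first.
- by move=> u; rewrite lee_fin; exact: le_trans (fg _).
- by move=> u; rewrite lee_fin.
apply: le_ereal_sup => _ [h hf <-]; exists h => //= u.
by apply: le_trans (hf u) _; rewrite lee_fin.
Qed.

Lemma integral_RnZ n (g : 'cV[R]_n -> R) c : 0 <= c -> measurable_vec g ->
  (forall x, 0 <= g x) ->
  integral_Rn (fun x => c * g x) = (c%:E * integral_Rn g)%E.
Proof.
move=> c0 mg g0; rewrite /integral_Rn; under eq_integral do rewrite EFinM.
apply: ge0_integralZl => //; first exact/measurable_EFinP.
by move=> u _; rewrite lee_fin.
Qed.

Lemma integral_Rn_sum n (I : finType) (g : I -> 'cV[R]_n -> R) :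
  (forall i, measurable_vec (g i)) -> (forall i x, 0 <= g i x) ->
  integral_Rn (fun x => \sum_i g i x) = (\sum_i integral_Rn (g i))%E.
Proof.
move=> mg g0; rewrite /integral_Rn; under eq_integral do rewrite -sumEFin.
apply: ge0_integral_sum => // i; first exact/measurable_EFinP/mg.
by move=> u _; rewrite lee_fin.
Qed.

Lemma integral_exp_diag n (d : 'I_n -> R) : (forall i, d i != 0) ->
  integral_Rn (fun x => expR (- norm2 (\col_i (d i * x i 0)))) =
  ((\prod_i `|d i|)^-1%:E * cone_mass n)%E.
Proof.
move=> d0; rewrite -(integral_Rn_affine (fun=> 0) d0 (measurable_cone_vec (n:=n))).
  congr integral_Rn; apply/funext => x; congr (expR (- norm2 _)).
  by apply/colP => i; rewrite !mxE addr0.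
by move=> x; exact: expR_ge0.
Qed.

(** T x + a = T (x + T^-1 a), and the measure is invariant under translations. *)
Lemma integral_cone_center n (T : 'M[R]_n) a t : T \in unitmx ->
  integral_Rn (cone_fun T a t) =
  ((expR t)%:E * integral_Rn (fun x => expR (- norm2 (T *m x))))%E.
Proof.
move=> uT.
have mE b : measurable_vec (fun x : 'cV[R]_n => expR (- norm2 (T *m x + b))).
  apply: measurableT_comp => //; apply: measurableT_comp => //.
  apply: measurable_norm2 => i; under eq_fun do rewrite mxE.
  by apply: measurable_funD => //; apply: measurable_mulmx => j; exact: measurable_coord.
transitivity (integral_Rn (fun x => expR t * expR (- norm2 (T *m x + a)))).
  by congr integral_Rn; apply/funext => x; rewrite /cone_fun expRD mulrC.
rewrite integral_RnZ; last 3 first.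
- exact: expR_ge0.
- exact: mE.
- by move=> x; exact: expR_ge0.
suff -> : integral_Rn (fun x => expR (- norm2 (T *m x + a))) =
    integral_Rn (fun x => expR (- norm2 (T *m x))) by [].
have m0 : measurable_vec (fun x : 'cV[R]_n => expR (- norm2 (T *m x))).
  suff <- : (fun x => expR (- norm2 (T *m x + 0))) =
    (fun x : 'cV[R]_n => expR (- norm2 (T *m x))) by exact: mE.
  by apply/funext => x; rewrite addr0.
have := @integral_Rn_affine R n (fun=> 1) (fun i => (invmx T *m a) i 0) _
  (fun=> oner_neq0 R) m0 (fun x => expR_ge0 _).
rewrite big1 => [|i _]; last by rewrite normr1.
rewrite invr1 mul1e => <-.
suff <- : (fun x : 'cV[R]_n => expR (- norm2 (T *m (\col_i (1 * x i 0 + (invmx T *m a) i 0)))))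
  = (fun x => expR (- norm2 (T *m x + a))) by [].
apply/funext => x; rewrite (_ : \col_i _ = x + invmx T *m a); last first.
  by apply/colP => i; rewrite !mxE mul1r.
by rewrite mulmxDr mulKVmx.
Qed.

Lemma col_unitmx_neq0 n (T : 'M[R]_n) i : T \in unitmx -> col i T != 0.
Proof.
move=> uT; apply/eqP => c0.
have : delta_mx i 0 = 0 :> 'cV[R]_n by rewrite -(mulKmx uT (delta_mx i 0)) -colE c0 mulmx0.
by move/colP/(_ i); rewrite !mxE !eqxx => /eqP; rewrite oner_eq0.
Qed.

(* Averaging over the coordinate reflections, which preserve the measure, replaces T
   by the diagonal matrix of the norms of its columns. *)
Lemma integral_cone_ge n (T : 'M[R]_n) a t : T \in unitmx ->
  ((expR t / \prod_i norm2 (col i T))%:E * cone_mass n <= integral_Rn (cone_fun T a t))%E.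
Proof.
move=> uT; rewrite integral_cone_center; last exact: uT.
rewrite EFinM -muleA; apply: lee_wpmul2l; first by rewrite lee_fin expR_ge0.
have tau0 i : norm2 (col i T) != 0 by rewrite norm2_eq0 col_unitmx_neq0.
have -> : \prod_i norm2 (col i T) = \prod_i `|norm2 (col i T)|.
  by apply: eq_bigr => i _; rewrite ger0_norm ?norm2_ge0.
have := integral_exp_diag tau0; set G := fun x => expR (- norm2 (\col_i _)) => <-.
set F := fun x => expR (- norm2 (T *m x)).
have mF : measurable_vec F.
  apply: measurableT_comp => //; apply: measurableT_comp => //.
  by apply: measurable_norm2; apply: measurable_mulmx => j; exact: measurable_coord.
have mG : measurable_vec G.
  apply: measurableT_comp => //; apply: measurableT_comp => //.
  apply: measurable_norm2 => i; under eq_fun do rewrite mxE.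
  by apply: measurable_funM => //; exact: measurable_coord.
have F0 x : 0 <= F x by exact: expR_ge0.
have G0 x : 0 <= G x by exact: expR_ge0.
pose I := {ffun 'I_n -> bool}.
(* Pointwise form of the bound: the points [flip s x] have images under T whose mean square norm is
   that of the diagonal image, and [sum_expRN_ge] compares the exponentials. *)
have GF x : #|{: I}|%:R * G x <= \sum_(s : I) F (flip s x).
  apply: sum_expRN_ge => [|i|]; [exact: norm2_ge0..|].
  exact: sum_sqr_norm2_flip.
have flipE (s : I) : integral_Rn (fun x => F (flip s x)) = integral_Rn F.
  have s0 i : (-1) ^+ s i != 0 :> R by rewrite signr_eq0.
  have := integral_Rn_affine (fun=> 0) s0 mF F0.
  rewrite big1 => [|i _]; last by rewrite normr_sign.
  rewrite invr1 mul1e => <-.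
  suff -> : (fun x : 'cV[R]_n => F (\col_i ((-1) ^+ s i * x i 0 + 0))) = (fun x => F (flip s x)) by [].
  apply/funext => x; rewrite (_ : \col_i _ = flip s x)//.
  by apply/colP => i; rewrite !mxE addr0.
have mFf (s : I) : measurable_vec (fun x => F (flip s x)).
  apply: (measurable_vec_comp mF) => i; under eq_fun do rewrite mxE.
  by apply: measurable_funM => //; exact: measurable_coord.
move: F G mF mG F0 G0 GF flipE mFf => F G mF mG F0 G0 GF flipE mFf.
have cI : 0 < #|{: I}|%:R :> R.
  by rewrite ltr0n; apply/card_gt0P; exists [ffun=> true].
(* Both sides are multiplied by the number of sign vectors, which turns averages into finite
   sums. *)
rewrite -(@lee_pmul2l _ #|{: I}|%:R%:E)// -integral_RnZ ?ler0n//.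
have -> : (#|{: I}|%:R%:E * integral_Rn F = \sum_(s : I) integral_Rn (fun x => F (flip s x)))%E.
  rewrite (_ : #|{: I}|%:R%:E = \sum_(s : I) 1%:E)%E; last by rewrite sumEFin sumr_const.
  by rewrite ge0_sume_distrl//; apply: eq_bigr => s _; rewrite mul1e flipE.
rewrite -integral_Rn_sum//.
by apply: le_integral_Rn => x; rewrite ?mulr_ge0 ?ler0n.
Qed.

Lemma integral_cone_diag n (d : 'rV[R]_n) a t : (forall i, 0 < d 0 i) ->
  integral_Rn (cone_fun (diag_mx d) a t) =
  ((expR t / \prod_i d 0 i)%:E * cone_mass n)%E.
Proof.
move=> d0; have d_neq0 i : d 0 i != 0 by rewrite gt_eqF.
rewrite integral_cone_center; last first.
  by rewrite unitmxE det_diag unitfE; apply/prodf_neq0 => i _.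
rewrite EFinM -muleA.
have -> : \prod_i d 0 i = \prod_i `|d 0 i|.
  by apply: eq_bigr => i _; rewrite gtr0_norm.
rewrite -(integral_exp_diag d_neq0).
suff -> : (fun x => expR (- norm2 (diag_mx d *m x))) =
  (fun x : 'cV[R]_n => expR (- norm2 (\col_i (d 0 i * x i 0)))) by [].
apply/funext => x; suff -> : diag_mx d *m x = \col_i (d 0 i * x i 0) by [].
by apply/colP => i; rewrite mul_diag_mx !mxE.
Qed.

End ConeIntegral.

(** * Splitting off the first coordinate; the integral of exp(-|x|) is finite, and positive in
    dimension one *)

Section Mass.
Context {R : realType}.
Notation mu := (@lebesgue_measure R).

Definition tl n (x : 'cV[R]_n.+1) : 'cV[R]_n := \col_i x (lift ord0 i) 0.

Lemma tlD n (x y : 'cV[R]_n.+1) : tl (x + y) = tl x + tl y.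
Proof. by apply/colP => i; rewrite !mxE. Qed.

Lemma tlZ n c (x : 'cV[R]_n.+1) : tl (c *: x) = c *: tl x.
Proof. by apply/colP => i; rewrite !mxE. Qed.

Lemma dot_tl n (x y : 'cV[R]_n.+1) : dot x y = x 0 0 * y 0 0 + dot (tl x) (tl y).
Proof.
rewrite /dot big_ord_recl; congr (_ + _).
by apply: eq_bigr => i _; rewrite !mxE.
Qed.

Lemma sqr_norm2_tl n (x : 'cV[R]_n.+1) :
  norm2 x ^+ 2 = x 0 0 ^+ 2 + norm2 (tl x) ^+ 2.
Proof. by rewrite !sqr_norm2 dot_tl -expr2. Qed.

Lemma norm2_tl_le n (x : 'cV[R]_n.+1) : norm2 (tl x) <= norm2 x.
Proof.
rewrite -(ler_pXn2r (n := 2))// ?nnegrE ?norm2_ge0//.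
by rewrite (sqr_norm2_tl x) lerDr sqr_ge0.
Qed.

Definition vcons n (r : R) (v : 'cV[R]_n) : 'cV[R]_n.+1 :=
  \col_i (if unlift ord0 i is Some j then v j 0 else r).

Lemma vcons0 n r (v : 'cV[R]_n) : vcons r v 0 0 = r.
Proof. by rewrite mxE unlift_none. Qed.

Lemma tl_vcons n r (v : 'cV[R]_n) : tl (vcons r v) = v.
Proof. by apply/colP => i; rewrite !mxE liftK. Qed.

Lemma col_mx_vcons n r (v : 'cV[R]_n) : col_mx (r%:M : 'cV_1) v = vcons r v.
Proof.
apply/colP => i; rewrite [RHS]mxE; case: unliftP => [j ->|->].
  rewrite (_ : lift ord0 j = rshift 1 j) ?(@col_mxEd _ 1 n 1)//.
  exact: val_inj.
have -> : (ord0 : 'I_n.+1) = lshift n (0 : 'I_1) by exact: val_inj.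
by rewrite (@col_mxEu _ 1 n 1) mxE eqxx mulr1n.
Qed.

(** The function is dominated by 1/k times the sum of the exponential density and its mirror image,
    both of total mass 1. *)
Lemma integral_expNabs_fin (k : R) : 0 < k ->
  (\int[mu]_x (expR (- (k * `|x|)))%:E < +oo)%E.
Proof.
move=> k0; pose p := @exponential_pdf R k.
have mp : measurable_fun setT (EFin \o p).
  by apply/measurable_EFinP; exact: measurable_exponential_pdf.
have p0 x : (0 <= (p x)%:E)%E by rewrite lee_fin exponential_pdf_ge0 ?ltW.
have i1 : (\int[mu]_x (p x)%:E = 1)%E by exact: integral_exponential_pdf.
have mpN : measurable_fun setT (fun x : R => (p (-1 * x + 0))%:E).
  by apply: (measurableT_comp mp); apply: measurable_funD.
have i2 : (\int[mu]_x (p (-1 * x + 0))%:E = 1)%E.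
  have := ge0_integral_affine (0 : R) (_ : -1 != 0) mp p0; rewrite oppr_eq0 oner_neq0.
  by move=> -> //; rewrite i1 normrN1 invr1 mul1e.
apply: (@le_lt_trans _ _ (\int[mu]_x (k^-1%:E * ((p x)%:E + (p (-1 * x + 0)%R)%:E)))%E).
  apply: ge0_le_integral => //.
  - apply/measurable_EFinP; apply: measurableT_comp => //; apply: measurableT_comp => //.
    by apply: measurable_funM => //; exact: measurableT_comp.
  - by apply: measurable_funeM; exact: emeasurable_funD.
  move=> x _; rewrite -EFinD -EFinM lee_fin [leRHS]mulrC ler_pdivlMr//.
  have [x0|x0] := leP 0 x.
    rewrite ger0_norm// /p exponential_pdfE//.
    by rewrite -mulNr [leLHS]mulrC lerDl exponential_pdf_ge0// ltW.
  rewrite ltr0_norm// /p [X in _ + X]exponential_pdfE; last first.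
    by rewrite mulN1r addr0 oppr_ge0 ltW.
  by rewrite -mulNr mulN1r addr0 [leLHS]mulrC lerDr exponential_pdf_ge0// ltW.
rewrite ge0_integralZl//; last 3 first.
- exact: emeasurable_funD.
- by move=> x _; rewrite adde_ge0.
- by rewrite lee_fin invr_ge0 ltW.
by rewrite ge0_integralD// i1 i2 -EFinD -EFinM ltry.
Qed.

Lemma measurable_expNnorm2 n (c : R) :
  measurable_vec (fun x : 'cV[R]_n => expR (- (c * norm2 x))).
Proof.
apply: measurableT_comp => //; apply: measurableT_comp => //.
apply: measurable_funM => //.
by apply: measurable_norm2 => i; exact: measurable_coord.
Qed.

(** Since |x| >= (|x_0| + |x'|) / 2, the integrand is bounded by a product of functions of x_0 and
    of x'. The rate is halved at each dimension, so the induction runs over all c > 0. *)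
Lemma integral_expNnorm2_fin n (c : R) : 0 < c ->
  (integral_Rn (fun x : 'cV[R]_n => expR (- (c * norm2 x))) < +oo)%E.
Proof.
elim: n c => [|n IHn] c c0.
  rewrite /integral_Rn integral_dirac//; first by rewrite diracT mul1e ltry.
rewrite integral_RnS; last 2 first.
- exact: measurable_expNnorm2.
- by move=> x; exact: expR_ge0.
have c2 : 0 < c / 2 by rewrite divr_gt0.
set K := integral_Rn (fun x : 'cV[R]_n => expR (- (c / 2 * norm2 x))).
have K0 : (0 <= K)%E by apply: integral_Rn_ge0 => x; exact: expR_ge0.
have Koo : (K < +oo)%E by exact: IHn.
pose G (x : R) := integral_Rn (fun v : 'cV[R]_n => expR (- (c * norm2 (col_mx (x%:M : 'cV_1) v)))).
have mG : measurable_fun setT G.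
  exact: (@measurable_integral_RnS R n (fun x => expR (- (c * norm2 x)))
    (@measurable_expNnorm2 n.+1 c) (fun x => expR_ge0 _)).
have mE : measurable_fun setT (fun x : R => (expR (- (c / 2 * `|x|)))%:E).
  apply/measurable_EFinP; apply: measurableT_comp => //.
  by apply: measurableT_comp => //; apply: measurable_funM => //; exact: measurableT_comp.
have GK x : (G x <= K * (expR (- (c / 2 * `|x|)))%:E)%E.
  rewrite /G muleC -integral_RnZ; last 3 first.
  - exact: expR_ge0.
  - exact: measurable_expNnorm2.
  - by move=> v; exact: expR_ge0.
  apply: le_integral_Rn => v; first exact: expR_ge0.
  rewrite -expRD ler_expR -opprD lerN2 -mulrDr -mulrA ler_pM2l// mulrC.
  rewrite ler_pdivrMr// mulr_natr mulr2n col_mx_vcons lerD//.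
    by have := norm2_coord (vcons x v) 0; rewrite vcons0.
  by have := norm2_tl_le (vcons x v); rewrite tl_vcons.
have G0 x : (0 <= G x)%E.
  by apply: integral_Rn_ge0 => v; exact: expR_ge0.
rewrite -/G; clearbody G K.
apply: (@le_lt_trans _ _ (\int[mu]_x (K * (expR (- (c / 2 * `|x|)))%:E))%E).
  by apply: ge0_le_integral => //; exact: measurable_funeM.
rewrite ge0_integralZl//.
apply: lte_mul_pinfty => //; first by rewrite ge0_fin_numE.
exact: integral_expNabs_fin.
Qed.

Lemma cone_mass_fin n : (@cone_mass R n < +oo)%E.
Proof.
have := @integral_expNnorm2_fin n 1 ltr01; rewrite /cone_mass.
suff -> : (fun x : 'cV[R]_n => expR (- (1 * norm2 x))) = (fun x => expR (- norm2 x)) by [].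
by apply/funext => x; rewrite mul1r.
Qed.

(** The integrand is at least 1/e on [0, 1]. Positivity allows the mass to be cancelled when two
    one-dimensional cones are compared. *)
Lemma cone_mass1_gt0 : (0 < @cone_mass R 1)%E.
Proof.
rewrite /cone_mass integral_RnS; last 2 first.
- exact: measurable_cone_vec.
- by move=> x; exact: expR_ge0.
have i0 : (0 < \int[mu]_(x in `[0%R, 1%R]) (expR (- 1))%:E)%E.
  rewrite integral_cst//= lebesgue_measure_itv/= lte_fin ltr01 oppr0 adde0 mule1.
  by rewrite lte_fin expR_gt0.
pose G (x : R) := integral_Rn (fun v : 'cV[R]_0 => expR (- norm2 (col_mx (x%:M : 'cV_1) v))).
have mG : measurable_fun setT G.
  exact: (@measurable_integral_RnS R 0 (fun x => expR (- norm2 x))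
    (@measurable_cone_vec R 1) (fun x => expR_ge0 _)).
have G0 x : (0 <= G x)%E.
  by apply: integral_Rn_ge0 => v; exact: expR_ge0.
have G1 (x : R) : 0 <= x -> x <= 1 ->
    ((expR (-1))%:E <= G x)%E.
  move=> x0 x1; rewrite /G /integral_Rn integral_dirac// diracT mul1e lee_fin ler_expR lerN2.
  rewrite col_mx_vcons norm2_le// dot_tl tl_vcons vcons0.
  by rewrite  /dot big_ord0 addr0 -expr2 expr1n expr_le1.
rewrite -/G; clearbody G.
apply: lt_le_trans i0 _; rewrite integral_mkcond.
apply: ge0_le_integral => //.
- by move=> x _; rewrite erestrict_ge0// => y _; rewrite lee_fin expR_ge0.
- apply/(measurable_restrictT _ _).1 => //; exact: measurable_cst.
move=> x _; rewrite patchE; case: ifPn => // /[!inE]/=.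
by rewrite in_itv/= => /andP[x0 x1]; exact: G1.
Qed.

End Mass.

(** * Loewner functions and polars *)

Section LogConcave.
Context {R : realType}.

(** One shape for the examples, for cone functions and for positive multiples of indicators. The
    potential [p] is real-valued, so the polar lemmas below stay within the reals. *)
Definition trunc_exp n (S : pred 'cV[R]_n) (p : 'cV[R]_n -> R) x :=
  if S x then expR (- p x) else 0.

Lemma trunc_exp_ge0 n S p (x : 'cV[R]_n) : 0 <= trunc_exp S p x.
Proof. by rewrite /trunc_exp; case: ifP => // _; exact: expR_ge0. Qed.

Lemma trunc_exp_gt0 n S p (x : 'cV[R]_n) : (0 < trunc_exp S p x) = S x.
Proof. by rewrite /trunc_exp; case: ifP => // _; rewrite ?expR_gt0 ?ltxx. Qed.

Lemma trunc_exp_neq0 n S p (x : 'cV[R]_n) : (trunc_exp S p x != 0) = S x.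
Proof. by rewrite -(trunc_exp_gt0 S p) lt0r trunc_exp_ge0 andbT. Qed.

Lemma log_concave_trunc_exp n (S : pred 'cV[R]_n) p :
  (forall l x y, 0 <= l -> l <= 1 -> S x -> S y ->
    S (l *: x + (1 - l) *: y) /\
    p (l *: x + (1 - l) *: y) <= l * p x + (1 - l) * p y) ->
  log_concave (trunc_exp S p).
Proof.
move=> H; exists (fun x => if S x then (p x)%:E else +oo%E); last first.
  by move=> x; rewrite /trunc_exp; case: ifP.
split=> [x|l x y l0 l1]; first by case: ifP.
(* The end values of l are separate because 0 * +oo = 0; for 0 < l < 1 an infinite value at x or y
   makes the right side infinite. *)
have [->|l_neq0] := eqVneq l 0.
  by rewrite scale0r add0r subr0 scale1r mul0e mul1e add0e.
have [->|l_neq1] := eqVneq l 1.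
  by rewrite subrr scale0r addr0 scale1r mul0e mul1e adde0.
have lp : 0 < l by rewrite lt0r l_neq0.
have l1p : 0 < 1 - l by rewrite subr_gt0 lt_neqAle l_neq1.
case: (boolP (S x)) => Sx; case: (boolP (S y)) => Sy.
- by have [-> ?] := H _ _ _ l0 l1 Sx Sy; rewrite -!EFinM -EFinD lee_fin.
- by rewrite (gt0_muley (x := (1 - l)%:E)) ?lte_fin// addey ?leey// -EFinM.
- by rewrite (gt0_muley (x := l%:E)) ?lte_fin// addye ?leey// -EFinM.
- by rewrite !gt0_muley ?lte_fin// addye ?leey.
Qed.

Lemma cone_potentialP n (f : 'cV[R]_n -> R) T a t x : 0 <= f x ->
  ((norm2 (aff T a x) - t)%:E <= potential f x)%E <-> f x <= cone_fun T a t x.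
Proof.
rewrite le_eqVlt => /predU1P[fx0|fx].
  rewrite /potential -fx0 /lne lexx /= leey; split => // _.
  exact: ltW (cone_fun_gt0 _ _ _ _).
rewrite /potential lne_EFin// -EFinN lee_fin /cone_fun.
rewrite -[X in (X <= expR _)](lnK fx) ler_expR; split=> h; lra.
Qed.

Lemma loewner_feasibleP n (f : 'cV[R]_n -> R) T a t : (forall x, 0 <= f x) ->
  loewner_feasible f T a t <-> T \in unitmx /\ forall x, f x <= cone_fun T a t x.
Proof.
by move=> f0; split=> -[uT h]; split=> // x; apply/cone_potentialP.
Qed.

Lemma unitmx_diag n (d : 'rV[R]_n) : (forall i, 0 < d 0 i) -> diag_mx d \in unitmx.
Proof.
move=> d0; rewrite unitmxE det_diag unitfE; apply/prodf_neq0 => i _.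
by rewrite gt_eqF.
Qed.

(** [integral_cone_ge] bounds every competitor from below, with equality for the diagonal candidate,
    so comparing the factors of [cone_mass] suffices. *)
Lemma loewner_optimal_diag n (f : 'cV[R]_n -> R) (d : 'rV[R]_n) a t :
  (forall x, 0 <= f x) -> (forall i, 0 < d 0 i) ->
  (forall x, f x <= cone_fun (diag_mx d) a t x) ->
  (forall T' a' t', T' \in unitmx -> (forall x, f x <= cone_fun T' a' t' x) ->
    expR t / \prod_i d 0 i <= expR t' / \prod_i norm2 (col i T')) ->
  loewner_optimal f (diag_mx d) a t.
Proof.
move=> f0 d0 fd opt; split.
  by apply/loewner_feasibleP => //; split=> //; exact: unitmx_diag.
move=> T' a' t' /(loewner_feasibleP _ _ _ f0)[uT' fT'].
rewrite integral_cone_diag//; apply: le_trans (integral_cone_ge _ _ uT').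
by apply: lee_wpmul2r; [exact: cone_mass_ge0 | rewrite lee_fin (opt T' a' t')].
Qed.

Lemma sym_posdef_diag n (d : 'rV[R]_n) : (forall i, 0 < d 0 i) ->
  sym_posdef (diag_mx d).
Proof.
move=> d0; split; first exact: tr_diag_mx.
move=> x x0; have [i xi0] : exists i, x i 0 != 0.
  apply/existsP; apply: contraNT x0; rewrite negb_exists => /forallP h.
  by apply/eqP/colP => i; rewrite mxE; apply/eqP; rewrite -[_ == _]negbK.
rewrite /dot (bigD1 i)//=; apply: ltr_wpDr.
  apply: sumr_ge0 => j _; rewrite mul_diag_mx mxE mulrCA -expr2.
  by rewrite mulr_ge0 ?sqr_ge0// ltW.
by rewrite mul_diag_mx mxE mulrCA -expr2 mulr_gt0// lt0r sqr_ge0 sqrf_eq0 xi0.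
Qed.

Lemma is_loewner_diag n (f : 'cV[R]_n -> R) (d : 'rV[R]_n) a t :
  (forall x, 0 <= f x) -> (forall i, 0 < d 0 i) ->
  (forall x, f x <= cone_fun (diag_mx d) a t x) ->
  (forall T' a' t', T' \in unitmx -> (forall x, f x <= cone_fun T' a' t' x) ->
    expR t / \prod_i d 0 i <= expR t' / \prod_i norm2 (col i T')) ->
  is_loewner f (cone_fun (diag_mx d) a t) (- (invmx (diag_mx d) *m a)).
Proof.
move=> f0 d0 fd opt; exists (diag_mx d), a, t; split=> //.
  exact: sym_posdef_diag.
exact: loewner_optimal_diag.
Qed.

Lemma integral_cone_diag_fin n (d : 'rV[R]_n) a t : (forall i, 0 < d 0 i) ->
  (integral_Rn (cone_fun (diag_mx d) a t) < +oo)%E.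
Proof.
move=> d0; rewrite integral_cone_diag//; apply: lte_mul_pinfty => //.
  by rewrite lee_fin divr_ge0 ?expR_ge0// prodr_ge0// => i _; exact: ltW.
exact: cone_mass_fin.
Qed.

Lemma polar_trunc_exp_le n (z y x : 'cV[R]_n) (S : pred 'cV[R]_n) p : S x ->
  polar z (trunc_exp S p) y <= expR (- (dot (x - z) (y - z) - p x)).
Proof.
move=> Sx; apply: ge_inf; last first.
  exists x; first by rewrite /supp/= trunc_exp_neq0.
  by rewrite /trunc_exp Sx -expRN -expRD; congr expR; ring.
exists 0 => _ [u _ <-].
by rewrite divr_ge0 ?expR_ge0// trunc_exp_ge0.
Qed.

Lemma polar_trunc_exp_ge n (z y : 'cV[R]_n) (S : pred 'cV[R]_n) p c : (exists x, S x) ->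
  (forall x, S x -> dot (x - z) (y - z) - p x <= c) ->
  expR (- c) <= polar z (trunc_exp S p) y.
Proof.
move=> [x0 Sx0] h; apply: lb_le_inf.
  by exists (expR (- dot (x0 - z) (y - z)) / trunc_exp S p x0), x0 => //;
     rewrite /supp/= trunc_exp_neq0.
move=> _ [x + <-]; rewrite /supp/= trunc_exp_neq0 => Sx.
rewrite /trunc_exp Sx -expRN -expRD ler_expR.
by have := h _ Sx; lra.
Qed.

Lemma polar_trunc_exp n (z y : 'cV[R]_n) (S : pred 'cV[R]_n) p x0 : S x0 ->
  (forall x, S x -> dot (x - z) (y - z) - p x <= dot (x0 - z) (y - z) - p x0) ->
  polar z (trunc_exp S p) y = expR (- (dot (x0 - z) (y - z) - p x0)).
Proof.
move=> Sx0 h; apply/eqP; rewrite eq_le polar_trunc_exp_le//=.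
by apply: polar_trunc_exp_ge => //; exists x0.
Qed.

(** An infinite Legendre transform: the quotients in the infimum become smaller than any e > 0, as
    seen with M = - ln e. *)
Lemma polar_trunc_exp_eq0 n (z y : 'cV[R]_n) (S : pred 'cV[R]_n) p :
  (forall M, exists2 x, S x & M <= dot (x - z) (y - z) - p x) ->
  polar z (trunc_exp S p) y = 0.
Proof.
move=> h; apply/eqP; rewrite eq_le; apply/andP; split.
  apply/ler_addgt0Pr => e e0; rewrite add0r; have [x Sx hx] := h (- ln e).
  apply: le_trans (polar_trunc_exp_le _ _ _ Sx) _.
  by rewrite -[leRHS]lnK// ler_expR lerNl.
have [x0 Sx0 _] := h 0; apply: lb_le_inf.
  by exists (expR (- dot (x0 - z) (y - z)) / trunc_exp S p x0), x0 => //;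
     rewrite /supp/= trunc_exp_neq0.
by move=> _ [x _ <-]; rewrite divr_ge0 ?expR_ge0// trunc_exp_ge0.
Qed.

End LogConcave.

(** * Determinants and John functions *)

Section John.
Context {R : realType}.

Lemma mul_mx_tr_dot n (w x : 'cV[R]_n) : w^T *m x = (dot w x)%:M.
Proof.
by apply/matrixP => i j; rewrite !ord1 !mxE mulr1n; apply: eq_bigr => k _; rewrite mxE.
Qed.

(* Householder: reflect in the hyperplane orthogonal to v - |v| e_0. *)
Lemma exists_reflection n (v : 'cV[R]_n.+1) : exists H : 'M[R]_n.+1,
  [/\ H *m H = 1%:M, forall x, norm2 (H *m x) = norm2 x
    & H *m v = norm2 v *: delta_mx 0 0].
Proof.
have [w wE] : exists w, w = v + (- norm2 v) *: delta_mx 0 0 by eexists.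
have [w0|w_neq0] := eqVneq w 0.
  exists 1%:M; split=> [|x|]; rewrite ?mul1mx//.
  by apply/eqP; rewrite -subr_eq0 -scaleNr -wE w0.
have ww : dot w w != 0 by rewrite dot_eq0.
have [c cww] : exists c, c * dot w w = 2 by exists (2 / dot w w); rewrite divfK.
have dv (x : 'cV[R]_n.+1) : dot (delta_mx 0 0) x = x 0 0.
  rewrite /dot (bigD1 0)//= big1 ?mxE ?eqxx ?mul1r ?addr0// => i i0.
  by rewrite mxE (negbTE i0) mul0r.
(* With this identity [c * dot w v] is 1, so the reflection sends v to v - w, which is |v| e_0. *)
have wwE : dot w w = 2 * dot w v.
  have n2 := sqr_norm2 v.
  rewrite wE !dotDl !dotDr !dotZl !dotZr -n2 (dotC v (delta_mx _ _)) !dv.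
  rewrite (_ : (delta_mx 0 0 : 'cV[R]_n.+1) 0 0 = 1) ?mxE ?eqxx//.
  by move: (norm2 v) (v 0 0) => a b; ring.
have HE (x : 'cV[R]_n.+1) : (1%:M - c *: (w *m w^T)) *m x = x - (c * dot w x) *: w.
  rewrite mulmxBl mul1mx -scalemxAl -mulmxA mul_mx_tr_dot -scalerA; congr (_ - _ *: _).
  by apply/colP => i; rewrite !mxE big_ord1 !mxE mulr1n mulrC.
exists (1%:M - c *: (w *m w^T)); split=> [|x|].
- rewrite mulmxBl mul1mx mulmxBr mulmx1 -scalemxAl -scalemxAr -mulmxA.
  rewrite (mulmxA w^T) mul_mx_tr_dot mul_scalar_mx -scalemxAr !scalerA cww.
  by rewrite (mulrC c) -scalerA scaler_nat mulr2n opprB addrK subrK.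
- rewrite HE /norm2; congr Num.sqrt.
  rewrite -scaleN1r scalerA !(dotDl, dotDr, dotZl, dotZr) (dotC x w).
  move: (dot x x) (dot w x) (dot w w) cww => X D W cW.
  transitivity (X + c * D ^+ 2 * (c * W - 2)); first by ring.
  by rewrite cW subrr mulr0 addr0.
- have cv : c * dot w v = 1.
    move: wwE cww; move: (dot w v) (dot w w) => X W -> h.
    by lra.
  rewrite HE cv scale1r wE scaleNr; move: (norm2 v *: delta_mx 0 0) => X.
  by rewrite opprB addrC subrK.
Qed.

(** Reflect the first column onto the first axis and expand the determinant along it. The columns of
    the remaining minor are tails of reflected columns, so their norms did not increase. *)
Lemma hadamard n (A : 'M[R]_n) : `|\det A| <= \prod_i norm2 (col i A).
Proof.
elim: n A => [|n IHn] A; first by rewrite det_mx00 normr1 big_ord0.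
have [H [HH Hn Hv]] := exists_reflection (col 0 A).
have dH : `|\det H| = 1.
  apply/eqP; rewrite -(@pexpr_eq1 _ _ 2)// -normrX expr2 -det_mulmx HH det1.
  by rewrite normr1.
have colH i : col i (H *m A) = H *m col i A by rewrite !colE mulmxA.
have -> : `|\det A| = `|\det (H *m A)| by rewrite det_mulmx normrM dH mul1r.
rewrite (expand_det_col _ ord0) big_ord_recl big1 => [|i _]; last first.
  have := congr1 (fun v : 'cV_n.+1 => v (lift ord0 i) 0) (etrans (colH 0) Hv).
  by rewrite !mxE/= mulr0 => ->; rewrite mul0r.
have -> : (H *m A) ord0 ord0 = norm2 (col 0 A).
  have := congr1 (fun v : 'cV_n.+1 => v 0 0) (etrans (colH 0) Hv).
  by rewrite !mxE/= mulr1.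
rewrite addr0 normrM ger0_norm ?norm2_ge0// big_ord_recl.
apply: ler_wpM2l; first exact: norm2_ge0.
rewrite /cofactor expr0 mul1r; apply: le_trans (IHn _) _.
apply: ler_prod => i _; rewrite norm2_ge0/= -Hn -colH.
apply: le_trans (norm2_tl_le _); rewrite le_eqVlt; apply/orP; left; apply/eqP.
by congr norm2; apply/colP => j; rewrite !mxE.
Qed.

Lemma det_le_prod_rows n (A : 'M[R]_n) : `|\det A| <= \prod_i norm2 (row i A)^T.
Proof.
rewrite -det_tr; apply: le_trans (hadamard _) _.
by rewrite le_eqVlt; apply/orP; left; apply/eqP/eq_bigr => i _; rewrite tr_row.
Qed.

(** Equality case of Cauchy-Schwarz, at the normalized row: the half-width of the ellipsoid in a
    coordinate direction is the norm of that row. *)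
Lemma exists_extreme n (A : 'M[R]_n) i : exists2 u, norm2 u <= 1 &
  (A *m u) i 0 = norm2 (row i A)^T.
Proof.
set r := (row i A)^T.
have E u : (A *m u) i 0 = dot r u.
  by rewrite mxE; apply: eq_bigr => k _; rewrite !mxE.
have [r0|r_neq0] := eqVneq r 0.
  by exists 0; rewrite ?norm2_0 ?ler01// E r0 dot0l norm2_0.
have rp : 0 < norm2 r by rewrite norm2_gt0.
exists ((norm2 r)^-1 *: r).
  by rewrite norm2Z ger0_norm ?invr_ge0 ?norm2_ge0// mulVf// gt_eqF.
by rewrite E dotZr -sqr_norm2 expr2 mulrA mulVf ?mul1r// gt_eqF.
Qed.

Lemma ball_fun_in n s (T : 'M[R]_n) a u : norm2 u <= 1 ->
  ball_fun s T a (aff T a u) = s.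
Proof. by move=> u1; rewrite /ball_fun indicE mem_set ?mulr1//; exists u. Qed.

Lemma john_feasible_ball n (f : 'cV[R]_n -> R) s T a : john_feasible f s T a ->
  forall u, norm2 u <= 1 -> s <= f (aff T a u).
Proof. by move=> [_ _ h] u u1; rewrite -[leLHS](ball_fun_in s T a u1). Qed.

(** The bound by [sup_norm f] follows from the value of f at the center of the ellipsoid, and off
    the ellipsoid the ball function is 0. *)
Lemma john_feasibleI n (f : 'cV[R]_n -> R) s T a : (forall x, 0 <= f x) ->
  T \in unitmx -> (forall u, norm2 u <= 1 -> s <= f (aff T a u)) ->
  john_feasible f s T a.
Proof.
move=> f0 uT h; split=> // [|x].
  apply: (@le_trans _ _ (`|f (aff T a 0)|%:E)%E).
    by rewrite lee_fin ger0_norm// h// norm2_0.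
  by apply: ereal_sup_ubound; exists (aff T a 0).
rewrite /ball_fun indicE; case: (boolP (x \in _)) => [|_]; last by rewrite mulr0.
by rewrite inE => -[u u1 <-]; rewrite mulr1 h.
Qed.

Lemma john_optimalI n (f : 'cV[R]_n -> R) s T a : (forall x, 0 <= f x) -> 0 <= s ->
  T \in unitmx -> (forall u, norm2 u <= 1 -> s <= f (aff T a u)) ->
  (forall s' T' a', 0 < s' -> T' \in unitmx ->
    (forall u, norm2 u <= 1 -> s' <= f (aff T' a' u)) ->
    s' * `|\det T'| <= s * `|\det T|) ->
  john_optimal f s T a.
Proof.
move=> f0 s0 uT h opt; split; first exact: john_feasibleI.
move=> s' T' a' F; have [s'0|s'0] := ltP 0 s'.
  by apply: (opt _ _ a') => //; [case: F|exact: john_feasible_ball F].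
by apply: le_trans (_ : 0 <= _); rewrite ?mulr_le0_ge0 ?mulr_ge0.
Qed.

End John.

(** * Counterexamples in every dimension *)

Section Axial.
Context {R : realType} {m : nat}.

Definition axial (a b : R) : 'rV[R]_m.+1 := \row_i (if i == ord0 then a else b).

Lemma prod_axial a b : \prod_i axial a b 0 i = a * b ^+ m.
Proof.
rewrite big_ord_recl mxE eqxx; congr (_ * _).
under eq_bigr do rewrite mxE.
by rewrite prodr_const card_ord.
Qed.

(** The condition on b is void for m = 0, where there are no tail coordinates; the second example
    takes b = m. *)
Lemma axial_gt0 a b : 0 < a -> ((0 < m)%N -> 0 < b) -> forall i, 0 < axial a b 0 i.
Proof.
move=> a0 b0 i; rewrite mxE; case: (unliftP ord0 i) => [j ->|->]; last by rewrite eqxx.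
by apply: b0; case: j => k /=; case: m.
Qed.

Lemma aff_axial0 a b c x :
  aff (diag_mx (axial a b)) (vcons c 0) x 0 0 = a * x 0 0 + c.
Proof. by rewrite /aff mxE vcons0 mul_diag_mx !mxE eqxx. Qed.

Lemma tl_aff_axial a b c x :
  tl (aff (diag_mx (axial a b)) (vcons c 0) x) = b *: tl x.
Proof.
rewrite /aff tlD tl_vcons addr0; apply/colP => i.
by rewrite [LHS]mxE mul_diag_mx !mxE.
Qed.

Lemma vcons00 : vcons 0 0 = 0 :> 'cV[R]_m.+1.
Proof. by apply/colP => i; rewrite !mxE; case: unlift => // j; rewrite mxE. Qed.

Lemma norm2_vcons (c : R) (v : 'cV[R]_m) : norm2 (vcons c v) ^+ 2 = c ^+ 2 + norm2 v ^+ 2.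
Proof. by rewrite sqr_norm2_tl vcons0 tl_vcons. Qed.

Lemma norm2_vcons0 (c : R) : norm2 (vcons c 0 : 'cV[R]_m.+1) = `|c|.
Proof.
apply/eqP; rewrite -(eqrXn2 (n := 2)) ?norm2_ge0//.
by rewrite norm2_vcons norm2_0 expr0n addr0 real_normK ?num_real.
Qed.

Lemma dot_vcons (c : R) v (y : 'cV[R]_m.+1) : dot (vcons c v) y = c * y 0 0 + dot v (tl y).
Proof. by rewrite dot_tl vcons0 tl_vcons. Qed.

Lemma norm2_delta n (i : 'I_n) : norm2 (delta_mx i 0 : 'cV[R]_n) = 1.
Proof.
rewrite /norm2 /dot (bigD1 i)//= big1 => [|j ji].
  by rewrite !mxE !eqxx mulr1 addr0 sqrtr1.
by rewrite !mxE (negbTE ji) mul0r.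
Qed.

Lemma delta_vcons : delta_mx 0 0 = vcons 1 0 :> 'cV[R]_m.+1.
Proof.
apply/colP => i; rewrite !mxE; case: unliftP => [j ->|->]; last by rewrite !eqxx.
by rewrite mxE eq_sym (negbTE (neq_lift _ _)).
Qed.

Lemma delta_lift_vcons (i : 'I_m) :
  delta_mx (lift ord0 i) 0 = vcons 0 (delta_mx i 0) :> 'cV[R]_m.+1.
Proof.
apply/colP => k; rewrite !mxE; case: unliftP => [j ->|->].
  by rewrite mxE (inj_eq (@lift_inj _ _)).
by rewrite (negbTE (neq_lift _ _)).
Qed.

Lemma norm2_aff_axial_le a b c (x : 'cV[R]_m.+1) r : 0 <= r ->
  (a * x 0 0 + c) ^+ 2 + b ^+ 2 * norm2 (tl x) ^+ 2 <= r ^+ 2 ->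
  norm2 (aff (diag_mx (axial a b)) (vcons c 0) x) <= r.
Proof.
move=> r0 h; rewrite norm2_le// -sqr_norm2 sqr_norm2_tl aff_axial0 tl_aff_axial.
by rewrite norm2Z exprMn real_normK ?num_real.
Qed.

Lemma cone_funE n (T : 'M[R]_n) a t :
  cone_fun T a t = trunc_exp predT (fun x => norm2 (aff T a x) - t).
Proof. by apply/funext => x; rewrite /cone_fun /trunc_exp/= opprB addrC. Qed.

Lemma trunc_exp_le_cone n (S : pred 'cV[R]_n) p T a t :
  (forall x, trunc_exp S p x <= cone_fun T a t x) <->
  (forall x, S x -> norm2 (aff T a x) <= p x + t).
Proof.
split=> h x => [Sx|].
  by have := h x; rewrite /trunc_exp Sx /cone_fun ler_expR; lra.
rewrite /trunc_exp; case: ifPn => [Sx|_]; last exact: expR_ge0.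
by rewrite /cone_fun ler_expR; have := h x Sx; lra.
Qed.

Lemma ball_funE n (s : R) (T : 'M[R]_n) a : 0 < s ->
  ball_fun s T a = trunc_exp (fun x => `[< (aff T a @` unit_ball) x >]) (fun=> - ln s).
Proof.
move=> s0; apply/funext => x; rewrite /ball_fun /trunc_exp indicE opprK lnK//.
case: asboolP => h; first by rewrite mem_set ?mulr1.
by rewrite memNset ?mulr0.
Qed.

(** Asymptotic slope along a ray: translation and offset cost only a constant. This bounds a column
    of T in an unbounded direction of the support. *)
Lemma norm2_mulmx_le n (T : 'M[R]_n) a u k c :
  (forall r, 0 <= r -> norm2 (aff T a (r *: u)) <= r * k + c) -> norm2 (T *m u) <= k.
Proof.
move=> h; rewrite leNgt; apply/negP => kT.
have d0 : 0 < norm2 (T *m u) - k by rewrite subr_gt0.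
have C0 : 0 < norm2 a + `|c| + 1 by rewrite ltr_wpDl// addr_ge0 ?norm2_ge0.
(* At this r the excess r (|T u| - k) is larger than the total |a| + |c| of the constants. *)
pose r := (norm2 a + `|c| + 1) / (norm2 (T *m u) - k).
have r0 : 0 < r by rewrite divr_gt0.
have rE : r * (norm2 (T *m u) - k) = norm2 a + `|c| + 1 by rewrite divfK ?gt_eqF.
have := h r (ltW r0); have := norm2D (aff T a (r *: u)) (- a).
rewrite {1}/aff addrK norm2N -scalemxAr norm2Z (gtr0_norm r0).
have := ler_norm c; nra.
Qed.

(** The translation cancels in a difference. This bounds a column of T in a bounded direction of the
    support. *)
Lemma norm2_col_bound n (T : 'M[R]_n) a u v r :
  norm2 (aff T a u) <= r -> norm2 (aff T a v) <= r -> norm2 (T *m (u - v)) <= 2 * r.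
Proof.
move=> hu hv; have := norm2D (aff T a u) (- aff T a v).
rewrite norm2N /aff opprD addrACA subrr addr0 -mulmxBr; lra.
Qed.

End Axial.

(** * The two families of examples and their polars at 0 *)

Section Counterexamples.
Context {R : realType} {m : nat}.
Notation V := 'cV[R]_m.+1.

(* Support function of the interval [-1, 3]. *)
Definition hgt (r : R) := 2 * `|r| + r.

Lemma hgt_convex l r s : 0 <= l -> l <= 1 ->
  hgt (l * r + (1 - l) * s) <= l * hgt r + (1 - l) * hgt s.
Proof.
move=> l0 l1; rewrite /hgt.
have l1' : 0 <= 1 - l by rewrite subr_ge0.
have := ler_normD (l * r) ((1 - l) * s).
rewrite (normrM l) (normrM (1 - l)) (ger0_norm l0) (ger0_norm l1').
by move: `|_ + _| `|r| `|s| => *; lra.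
Qed.

Lemma abs_le_hgt r : `|r| <= hgt r.
Proof. by rewrite /hgt; have := ler_norm (- r); rewrite normrN; lra. Qed.

(** Membership of [-1, 3] is written |y - 1| <= 2. With [exists_gt_hgt], this says that the Legendre
    transform of [hgt] is 0 on that interval and infinite off it. *)
Lemma mul_le_hgt r y : `|y - 1| <= 2 -> r * y <= hgt r.
Proof.
rewrite ler_norml /hgt => /andP[h1 h2].
by have [r0|r0] := lerP 0 r; [rewrite ger0_norm//|rewrite ltr0_norm//]; nra.
Qed.

Lemma exists_gt_hgt y M : 2 < `|y - 1| -> exists r, M <= r * y - hgt r.
Proof.
move=> h; have d0 : 0 < `|y - 1| - 2 by rewrite subr_gt0.
pose r := `|M| / (`|y - 1| - 2).
have r0 : 0 <= r by rewrite divr_ge0// ltW.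
have rM : r * (`|y - 1| - 2) = `|M| by rewrite divfK ?gt_eqF.
have := ler_norm M; rewrite -rM => hM.
have [y1|y1] := lerP 1 y.
  by exists r; rewrite /hgt ger0_norm//; move: hM; rewrite ger0_norm ?subr_ge0//; lra.
exists (- r); rewrite /hgt normrN ger0_norm//; move: hM.
by rewrite ltr0_norm ?subr_lt0//; lra.
Qed.

(** [radial_ex] and [cyl_ex] are the two examples. [tail_ball] is the support of [cyl_ex];
    [tail_cyl] and [slab] turn out to be the supports of the polars at 0 of [radial_ex] and
    [cyl_ex]. *)
Definition radial_ex : V -> R := trunc_exp predT (fun x => hgt (x 0 0) + norm2 (tl x)).
Definition tail_cyl : pred V := fun y => (`|y 0 0 - 1| <= 2) && (norm2 (tl y) <= 1).
Definition tail_ball : pred V := fun x => norm2 (tl x) <= 1.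
Definition cyl_ex : V -> R := trunc_exp tail_ball (fun x => hgt (x 0 0)).
Definition slab : pred V := fun y => `|y 0 0 - 1| <= 2.

Lemma convex_coord l (x y : V) : (l *: x + (1 - l) *: y) 0 0 = l * x 0 0 + (1 - l) * y 0 0.
Proof. by rewrite !mxE. Qed.

Lemma convex_norm2_tl l (x y : V) : 0 <= l -> l <= 1 ->
  norm2 (tl (l *: x + (1 - l) *: y)) <= l * norm2 (tl x) + (1 - l) * norm2 (tl y).
Proof.
move=> l0 l1; rewrite tlD !tlZ; apply: le_trans (norm2D _ _) _.
by rewrite !norm2Z ger0_norm// ger0_norm// subr_ge0.
Qed.

Lemma polar_radial_ex : polar 0 radial_ex = trunc_exp tail_cyl (fun=> 0).
Proof.
apply/funext => y; rewrite /trunc_exp /tail_cyl oppr0 expR0 /radial_ex.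
case: (lerP `|y 0 0 - 1| 2) => hy /=; last first.
  apply: polar_trunc_exp_eq0 => M; have [r hr] := exists_gt_hgt M hy.
  by exists (vcons r 0) => //; rewrite !subr0 dot_vcons vcons0 tl_vcons dot0l norm2_0 !addr0.
case: (lerP (norm2 (tl y)) 1) => hy' /=.
  rewrite (@polar_trunc_exp _ _ _ _ _ _ 0)//= => [|x _]; rewrite !subr0 ?dot0l.
    by rewrite [tl 0](_ : _ = 0) ?norm2_0 ?mxE ?/hgt ?normr0 ?mulr0 ?addr0 ?subr0 ?oppr0 ?expR0//;
      apply/colP => i; rewrite !mxE.
  rewrite [tl 0](_ : _ = 0) ?norm2_0 ?mxE; last by apply/colP => i; rewrite !mxE.
  rewrite /hgt normr0 mulr0 !addr0 subr0 -/(hgt _) dot_tl.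
  have := mul_le_hgt (x 0 0) hy; have := dot_le_norm2 (tl x) (tl y).
  have := norm2_ge0 (tl x); nra.
apply: polar_trunc_exp_eq0 => M.
have d0 : 0 < norm2 (tl y) - 1 by rewrite subr_gt0.
(* Along r y' the quantity is r |y'| (|y'| - 1), which exceeds r (|y'| - 1) = |M| because |y'| >
   1. *)
pose r := `|M| / (norm2 (tl y) - 1).
have r0 : 0 <= r by rewrite divr_ge0// ltW.
have rM : r * (norm2 (tl y) - 1) = `|M| by rewrite divfK ?gt_eqF.
exists (vcons 0 (r *: tl y)) => //; rewrite !subr0 dot_vcons vcons0 tl_vcons mul0r.
rewrite add0r /hgt normr0 mulr0 !add0r dotZl -sqr_norm2 norm2Z ger0_norm//.
have := ler_norm M; rewrite -rM.
have : 0 <= r * (norm2 (tl y) - 1) * (norm2 (tl y) - 1).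
  exact: mulr_ge0 (mulr_ge0 r0 (ltW d0)) (ltW d0).
move: {rM} r r0 => r r0;  move: (norm2 (tl y)) => N *; nra.
Qed.

Lemma polar_cyl_ex : polar 0 cyl_ex = trunc_exp slab (fun y => norm2 (tl y)).
Proof.
apply/funext => y; rewrite /cyl_ex [RHS]/trunc_exp /slab.
case: (lerP `|y 0 0 - 1| 2) => hy /=; last first.
  apply: polar_trunc_exp_eq0 => M; have [r hr] := exists_gt_hgt M hy.
  exists (vcons r 0); first by rewrite /tail_ball tl_vcons norm2_0 ler01.
  by rewrite !subr0 dot_vcons vcons0 dot0l addr0.
(* The maximizer of the inner product with y' over the unit ball; for y' = 0 the inverse is 0 by
   convention and v = 0 still works. *)
pose v := (norm2 (tl y))^-1 *: tl y.
have vy : dot v (tl y) = norm2 (tl y).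
  rewrite dotZl -sqr_norm2; have [->|h] := eqVneq (norm2 (tl y)) 0.
    by rewrite expr0n mulr0.
  by rewrite expr2 mulrA mulVf// mul1r.
have v1 : norm2 v <= 1.
  rewrite norm2Z ger0_norm ?invr_ge0 ?norm2_ge0//.
  by have [->|h] := eqVneq (norm2 (tl y)) 0; rewrite ?mulr0 ?ler01// mulVf.
have E : dot (vcons 0 v - 0) (y - 0) - hgt ((vcons 0 v : V) 0 0) = norm2 (tl y).
  by rewrite !subr0 dot_vcons vcons0 mul0r add0r /hgt normr0 mulr0 addr0 subr0.
rewrite -[X in expR (- X)]E; apply: polar_trunc_exp.
  by rewrite /tail_ball tl_vcons.
move=> x Sx; rewrite E !subr0 dot_tl.
have := mul_le_hgt (x 0 0) hy; have := dot_le_norm2 (tl x) (tl y).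
by move: Sx; rewrite /tail_ball; have := norm2_ge0 (tl y); nra.
Qed.

End Counterexamples.

Section Bounds.
Context {R : realType} {m : nat}.
Notation V := 'cV[R]_m.+1.

Lemma prod_le_axial (F : 'I_m.+1 -> R) a b : (forall i, 0 <= F i) ->
  F ord0 <= a -> (forall i, F (lift ord0 i) <= b) -> \prod_i F i <= a * b ^+ m.
Proof.
move=> F0 Fa Fb; rewrite -prod_axial; apply: ler_prod => i _; rewrite F0/= mxE.
by case: (unliftP ord0 i) => [j ->|->]; rewrite ?eqxx// eq_sym (negbTE (neq_lift _ _)).
Qed.

Lemma coord_le_norm2_tl (x : V) i : `|x (lift ord0 i) 0| <= norm2 (tl x).
Proof. by have := norm2_coord (tl x) i; rewrite mxE. Qed.

(** The values at u and -u differ by twice the row norm at an extreme u, and both lie in an interval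
    of length 2 r; the center of the ellipsoid drops out. *)
Lemma norm2_row_le n (T : 'M[R]_n) a i c r :
  (forall u, norm2 u <= 1 -> `|aff T a u i 0 - c| <= r) -> norm2 (row i T)^T <= r.
Proof.
move=> h; have [u u1 uE] := exists_extreme T i.
have h1 := h u u1; have := h (- u); rewrite norm2N => /(_ u1); move: h1.
rewrite /aff mulmxN !mxE; move: uE; rewrite mxE => ->.
rewrite !ler_norml => /andP[_ h1] /andP[h2 _]; lra.
Qed.

Lemma trunc_exp_ball n (S : pred 'cV[R]_n) p s T a : 0 < s ->
  (forall u, norm2 u <= 1 -> s <= trunc_exp S p (aff T a u)) ->
  forall u, norm2 u <= 1 -> S (aff T a u) /\ s <= expR (- p (aff T a u)).
Proof.
move=> s0 h u u1; have := h u u1.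
by rewrite /trunc_exp; case: ifP => // _; rewrite leNgt s0.
Qed.

Lemma det_axial (a b : R) : 0 < a -> 0 < b ->
  `|\det (diag_mx (@axial R m a b))| = a * b ^+ m.
Proof.
by move=> a0 b0; rewrite det_diag prod_axial ger0_norm// mulr_ge0 ?exprn_ge0// ltW.
Qed.

Lemma interior_setT_nonempty (A : set V) : (forall x, A x) -> interior A !=set0.
Proof. by move=> h; exists 0; apply: filterE. Qed.

End Bounds.

(** * First counterexample: (L f)^0 differs from J(f^0) *)

Section FirstCounterexample.
Context {R : realType} {m : nat}.
Notation V := 'cV[R]_m.+1.

Let D := @axial R m 1 1.
Let D0 : forall i, 0 < D 0 i. Proof. by apply: axial_gt0 => // _; exact: ltr01. Qed.

Lemma radial_ex_le_cone (x : V) : radial_ex x <= cone_fun (diag_mx D) (vcons 0 0) 0 x.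
Proof.
move: x; apply/trunc_exp_le_cone => x _; rewrite addr0.
have h := abs_le_hgt (x 0 0); have n0 := norm2_ge0 (tl x).
apply: norm2_aff_axial_le; first by rewrite addr_ge0// (le_trans _ h).
rewrite mul1r addr0 expr1n mul1r -real_normK ?num_real//.
by have := normr_ge0 (x 0 0); nra.
Qed.

Lemma admissible_radial_ex : admissible (@radial_ex R m).
Proof.
split.
- apply: log_concave_trunc_exp => l x y l0 l1 _ _; split=> //.
  rewrite convex_coord; have := hgt_convex (x 0 0) (y 0 0) l0 l1.
  by have := convex_norm2_tl x y l0 l1; lra.
- apply: le_lt_trans (integral_cone_diag_fin (vcons 0 0) 0 D0).
  by apply: le_integral_Rn radial_ex_le_cone => x; exact: trunc_exp_ge0.
- by apply: interior_setT_nonempty => x; rewrite /supp/= trunc_exp_neq0.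
Qed.

(** The point 0 gives t >= 0 and rays along the axes bound every column by 1, so e^t over the
    product of column norms is at least 1. *)
Lemma loewner_radial_ex : is_loewner (@radial_ex R m) (cone_fun (diag_mx D) (vcons 0 0) 0) 0.
Proof.
have -> : (0 : V) = - (invmx (diag_mx D) *m vcons 0 0) by rewrite vcons00 mulmx0 oppr0.
apply: is_loewner_diag D0 radial_ex_le_cone _ => [x|T a t uT]; first exact: trunc_exp_ge0.
move=> /trunc_exp_le_cone/= h.
rewrite prod_axial expr1n mulr1 expR0 divr1.
have t0 : 0 <= t.
  have := h 0 isT; rewrite [tl 0](_ : _ = 0); last by apply/colP => i; rewrite !mxE.
  by rewrite norm2_0 !mxE /hgt normr0 mulr0 !add0r; apply: le_trans; exact: norm2_ge0.
(* The ray along -e_0, where [hgt] has slope 1 rather than 3. *)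
have col0 : norm2 (col ord0 T) <= 1.
  rewrite colE -norm2N -mulmxN.
  apply: (@norm2_mulmx_le _ _ _ a _ _ t) => r r0; apply: le_trans (h _ isT) _.
  rewrite delta_vcons !mxE unlift_none tlZ [tl _](_ : _ = 0); last first.
    by apply/colP => i; rewrite !mxE liftK mxE oppr0.
  rewrite scaler0 norm2_0 /hgt mulrN1 normrN ger0_norm//; lra.
have coli i : norm2 (col (lift ord0 i) T) <= 1.
  rewrite colE; apply: (@norm2_mulmx_le _ _ _ a _ _ t) => r r0.
  apply: le_trans (h _ isT) _; rewrite delta_lift_vcons tlZ tl_vcons norm2Z norm2_delta.
  by rewrite mxE vcons0 mulr0 /hgt normr0 mulr0 !add0r ger0_norm//.
have P0 : 0 < \prod_i norm2 (col i T).
  by apply: prodr_gt0 => i _; rewrite norm2_gt0 col_unitmx_neq0.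
rewrite ler_pdivlMr// mul1r.
apply: (@le_trans _ _ 1); last by rewrite -expR0 ler_expR.
have := prod_le_axial (fun i => norm2_ge0 (col i T)) col0 coli.
by rewrite expr1n mulr1.
Qed.

Lemma john_polar_radial_ex :
  is_john (polar 0 (@radial_ex R m)) (ball_fun 1 (diag_mx (axial 2 1)) (vcons 1 0)).
Proof.
exists 1, (diag_mx (axial 2 1)), (vcons 1 0); split => //.
rewrite polar_radial_ex; apply: john_optimalI => [x||||].
- exact: trunc_exp_ge0.
- exact: ler01.
- by apply: unitmx_diag; apply: axial_gt0 => // _.
- move=> u u1; rewrite /trunc_exp /tail_cyl aff_axial0 tl_aff_axial scale1r addrK normrM.
  have := norm2_coord u 0; have := norm2_tl_le u; rewrite (ger0_norm (_ : 0 <= 2))// => h1 h2.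
  by rewrite !ifT ?oppr0 ?expR0//; apply/andP; split; lra.
- move=> s T a s0 uT /(trunc_exp_ball s0) h.
  have n0 : norm2 (0 : V) <= 1 by rewrite norm2_0.
  have s1 : s <= 1 by have [_] := h 0 n0; rewrite oppr0 expR0.
  rewrite det_axial// expr1n mulr1 mul1r.
  have r0 : norm2 (row ord0 T)^T <= 2.
    by apply: (@norm2_row_le _ _ _ a _ 1) => u /h[/andP[]].
  have ri i : norm2 (row (lift ord0 i) T)^T <= 1.
    apply: (@norm2_row_le _ _ _ a _ 0) => u /h[/andP[_ +] _]; rewrite subr0.
    exact/le_trans/coord_le_norm2_tl.
  have := prod_le_axial (fun i => norm2_ge0 (row i T)^T) r0 ri.
  have := det_le_prod_rows T; rewrite expr1n; have := normr_ge0 (\det T).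
  by move: (\prod_i _) `|_| => P d; nra.
Qed.

Lemma polar_loewner_radial_ex :
  polar 0 (cone_fun (diag_mx D) (vcons 0 0) 0)
  <> ball_fun 1 (diag_mx (axial 2 1)) (vcons 1 0) :> (V -> R).
Proof.
move=> /(congr1 (fun F : V -> R => F (vcons 3 0))).
have -> : (vcons 3 0 : V) = aff (diag_mx (axial 2 1)) (vcons 1 0) (vcons 1 0).
  apply/colP => i; rewrite /aff mxE mul_diag_mx !mxE.
  by case: unliftP => [j _|->]; rewrite ?mxE ?eqxx; ring.
rewrite ball_fun_in ?norm2_vcons0 ?normr1// => h.
(* At (3, 0), the tip of the ellipsoid, testing with x = e_0 bounds the polar of the cone by exp(-(3
   - 1)), whereas the ball function is 1 there. *)
have := @polar_trunc_exp_le R m.+1 0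
  (aff (diag_mx (axial 2 1)) (vcons 1 0) (vcons 1 0)) (vcons 1 0) predT
  (fun x => norm2 (aff (diag_mx D) (vcons 0 0) x) - 0) isT.
rewrite -cone_funE h !subr0 dot_vcons dot0l aff_axial0 vcons0.
rewrite vcons00 /aff addr0.
rewrite (_ : diag_mx D *m _ = vcons 1 0); last first.
  apply/colP => i; rewrite mul_diag_mx !mxE; case: unliftP => [j _|->];
  by rewrite ?mxE ?mulr0// eqxx mul1r.
rewrite addr0 norm2_vcons0 normr1 -[leLHS]expR0 ler_expR; lra.
Qed.

End FirstCounterexample.

(** * Second counterexample: L(f^0) differs from (J f)^0 *)

Section SecondCounterexample.
Context {R : realType} {m : nat}.
Notation V := 'cV[R]_m.+1.

(** Tail columns are bounded by t, the first one by 1, so a cone costs at least e^t / t^m; for m > 0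
    this is least at t = m, which fixes both the tail slope and the offset. *)
Let D := @axial R m 1 m%:R.
Let D0 : forall i, 0 < D 0 i.
Proof. by apply: axial_gt0 => // m0; rewrite ltr0n. Qed.

Lemma cyl_ex_le_cone (x : V) : cyl_ex x <= cone_fun (diag_mx D) (vcons 0 0) m%:R x.
Proof.
move: x; apply/trunc_exp_le_cone => x Sx.
have h := abs_le_hgt (x 0 0); have n0 := norm2_ge0 (tl x).
have m0 : 0 <= m%:R :> R by rewrite ler0n.
apply: norm2_aff_axial_le; first by rewrite addr_ge0// (le_trans _ h).
rewrite mul1r addr0 -real_normK ?num_real//.
have : m%:R ^+ 2 * norm2 (tl x) ^+ 2 <= m%:R ^+ 2 :> R.
  by rewrite ler_piMr ?sqr_ge0// expr_le1.
by have := normr_ge0 (x 0 0); nra.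
Qed.

Lemma norm2_le_of_entries n (x : 'cV[R]_n) e : 0 <= e ->
  (forall i, `|x i 0| <= e) -> norm2 x <= n%:R * e.
Proof.
move=> e0 h; rewrite norm2_le ?mulr_ge0 ?ler0n//.
apply: le_trans (_ : \sum_(i < n) e ^+ 2 <= _).
  apply: ler_sum => i _; rewrite -expr2 -real_normK ?num_real//.
  by rewrite ler_pXn2r// nnegrE.
rewrite sumr_const card_ord exprMn -[leLHS]mulr_natl; apply: ler_wpM2r; first exact: sqr_ge0.
by rewrite -natrX ler_nat; case: n {x h} => // n; rewrite leq_pmulr.
Qed.

Lemma interior_supp_cyl_ex : interior (supp (@cyl_ex R m)) !=set0.
Proof.
exists 0; apply/nbhs_ballP; exists (m.+1%:R^-1) => /=; first by rewrite invr_gt0.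
move=> x hx; rewrite /supp/= trunc_exp_neq0 /tail_ball.
apply: le_trans (norm2_le_of_entries (e := m.+1%:R^-1) _ _) _.
- by rewrite invr_ge0.
- move=> i; have [_] := hx; move=> /(_ (lift ord0 i) 0).
  by rewrite /ball/= !mxE sub0r normrN => /ltW.
- by rewrite ler_pdivrMr ?ltr0n// mul1r ler_nat.
Qed.

Lemma admissible_cyl_ex : admissible (@cyl_ex R m).
Proof.
split; last exact: interior_supp_cyl_ex.
- apply: log_concave_trunc_exp => l x y l0 l1; rewrite /tail_ball => Sx Sy.
  rewrite convex_coord; split; last exact: hgt_convex.
  by have := convex_norm2_tl x y l0 l1; nra.
- apply: le_lt_trans (integral_cone_diag_fin (vcons 0 0) m%:R D0).
  by apply: le_integral_Rn cyl_ex_le_cone => x; exact: trunc_exp_ge0.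
Qed.

(** The minimum of e^t / t^m at t = m: raise t/m <= exp(t/m - 1) to the power m. *)
Lemma pow_le_expR (t : R) : 0 <= t -> expR m%:R * t ^+ m <= expR t * m%:R ^+ m.
Proof.
move=> t0; case: m => [|k]; first by rewrite !expr0 !mulr1 ler_expR.
have k0 : 0 < k.+1%:R :> R by rewrite ltr0n.
have : t / k.+1%:R <= expR (t / k.+1%:R - 1).
  by have := expR_ge1Dx (t / k.+1%:R - 1); rewrite addrCA subrr addr0.
rewrite -(ler_pXn2r (n := k.+1)) ?nnegrE ?expR_ge0 ?divr_ge0 ?ler0n//.
rewrite -expRM_natl mulrBr mulr1 mulrCA divff ?mulr1 ?gt_eqF//.
rewrite expRD expRN expr_div_n ler_pdivrMr ?exprn_gt0// mulrAC ler_pdivlMr ?expR_gt0//.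
by rewrite mulrC.
Qed.

Lemma loewner_cyl_ex : is_loewner (@cyl_ex R m) (cone_fun (diag_mx D) (vcons 0 0) m%:R) 0.
Proof.
have -> : (0 : V) = - (invmx (diag_mx D) *m vcons 0 0) by rewrite vcons00 mulmx0 oppr0.
apply: is_loewner_diag D0 cyl_ex_le_cone _ => [x|T a t uT]; first exact: trunc_exp_ge0.
move=> /trunc_exp_le_cone/= h.
have h0 (v : 'cV[R]_m) : norm2 v <= 1 -> norm2 (aff T a (vcons 0 v)) <= t.
  move=> v1; have := h (vcons 0 v); rewrite /tail_ball tl_vcons vcons0 => /(_ v1).
  by rewrite /hgt normr0 mulr0 !add0r.
have t0 : 0 <= t by apply: le_trans (h0 0 _); rewrite ?norm2_ge0 ?norm2_0.
rewrite prod_axial mul1r.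
have col0 : norm2 (col ord0 T) <= 1.
  rewrite colE -norm2N -mulmxN.
  apply: (@norm2_mulmx_le _ _ _ a _ _ t) => r r0; apply: le_trans (h _ _) _.
    rewrite /tail_ball delta_vcons tlZ [tl _](_ : _ = 0) ?scaler0 ?norm2_0//.
    by apply/colP => i; rewrite !mxE liftK mxE oppr0.
  rewrite delta_vcons !mxE unlift_none /hgt mulrN1 normrN ger0_norm//; lra.
(* The cylinder contains e_i and -e_i at height 0, and their difference is 2 e_i. *)
have coli i : norm2 (col (lift ord0 i) T) <= t.
  rewrite colE delta_lift_vcons.
  have := @norm2_col_bound _ _ T a (vcons 0 (delta_mx i 0)) (vcons 0 (- delta_mx i 0)) t.
  rewrite !h0 ?norm2N ?norm2_delta// => /(_ isT isT).
  rewrite (_ : _ - _ = 2 *: vcons 0 (delta_mx i 0)); last first.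
    apply/colP => k; rewrite !mxE; case: unliftP => [j _|_]; rewrite ?mxE; ring.
  by rewrite -scalemxAr norm2Z ger0_norm// ler_pM2l.
have P0 : 0 < \prod_i norm2 (col i T).
  by apply: prodr_gt0 => i _; rewrite norm2_gt0 col_unitmx_neq0.
have M0 : 0 < m%:R ^+ m :> R.
  by case: (posnP m) => [->|m0]; rewrite ?expr0// exprn_gt0// ltr0n.
rewrite ler_pdivlMr// mulrAC ler_pdivrMr//; apply: le_trans (pow_le_expR t0).
rewrite ler_pM2l ?expR_gt0//.
by have := prod_le_axial (fun i => norm2_ge0 (col i T)) col0 coli; rewrite mul1r.
Qed.

(** The interval [-1, 3] bounds the first column by t/2, and e^t / (t/2) is least at t = 1, whence
    the slope 1/2; with translation -1/2 the center is at 1. *)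
Let E := @axial R m (1 / 2) 1.
Let E0 : forall i, 0 < E 0 i.
Proof. by apply: axial_gt0 => [|_]; lra. Qed.

Lemma polar_cyl_ex_le_cone (x : V) :
  trunc_exp slab (fun y => norm2 (tl y)) x <= cone_fun (diag_mx E) (vcons (- (1 / 2)) 0) 1 x.
Proof.
move: x; apply/trunc_exp_le_cone => x Px.
have n0 := norm2_ge0 (tl x).
apply: norm2_aff_axial_le; first by rewrite addr_ge0.
by move: Px; rewrite /slab ler_norml => /andP[p1 p2]; nra.
Qed.

Lemma loewner_polar_cyl_ex : exists b,
  is_loewner (polar 0 (@cyl_ex R m)) (cone_fun (diag_mx E) (vcons (- (1 / 2)) 0) 1) b.
Proof.
exists (- (invmx (diag_mx E) *m vcons (- (1 / 2)) 0)); rewrite polar_cyl_ex.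
apply: is_loewner_diag E0 polar_cyl_ex_le_cone _ => [x|T a t uT]; first exact: trunc_exp_ge0.
move=> /trunc_exp_le_cone/= h.
have h0 (c : R) : `|c - 1| <= 2 -> norm2 (aff T a (vcons c 0)) <= t.
  move=> c1; have := h (vcons c 0); rewrite /slab tl_vcons vcons0 => /(_ c1).
  by rewrite norm2_0 add0r.
rewrite prod_axial expr1n mulr1.
have col0 : norm2 (col ord0 T) <= t / 2.
  rewrite colE delta_vcons.
  (* The endpoints 3 and -1 are at distance 4, so 4 |T e_0| <= 2 t. *)
  have := @norm2_col_bound _ _ T a (vcons 3 0) (vcons (-1) 0) t.
  have i3 : `|3 - 1| <= 2 :> R by rewrite ler_norml; lra.
  have i1 : `|-1 - 1| <= 2 :> R by rewrite ler_norml; lra.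
  move=> /(_ (h0 _ i3) (h0 _ i1)).
  rewrite (_ : _ - _ = 4 *: vcons 1 0); last first.
    apply/colP => k; rewrite !mxE; case: unliftP => [j _|_]; rewrite ?mxE; ring.
  by rewrite -scalemxAr norm2Z ger0_norm//; lra.
have coli i : norm2 (col (lift ord0 i) T) <= 1.
  rewrite colE; apply: (@norm2_mulmx_le _ _ _ a _ _ t) => r r0.
  apply: le_trans (h _ _) _.
    by rewrite delta_lift_vcons /slab mxE vcons0 mulr0 sub0r normrN normr1; lra.
  rewrite delta_lift_vcons tlZ tl_vcons norm2Z norm2_delta.
  by rewrite ger0_norm.
have P0 : 0 < \prod_i norm2 (col i T).
  by apply: prodr_gt0 => i _; rewrite norm2_gt0 col_unitmx_neq0.
have := prod_le_axial (fun i => norm2_ge0 (col i T)) col0 coli; rewrite expr1n mulr1 => P1.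
rewrite ler_pdivlMr//.
have : t <= expR (t - 1) by have := expR_ge1Dx (t - 1); rewrite addrCA subrr addr0.
rewrite expRD expRN ler_pdivlMr ?expR_gt0// => h1.
have e0 := expR_gt0 (1 : R).
apply: le_trans h1; rewrite div1r invrK mulrC (mulrC t); nra.
Qed.

(** The level set h <= c is [-c, c/3], of half-length 2c/3 and center -c/3; the product of e^-c and
    2c/3 is largest at c = 1. *)
Definition john_cyl_ex : V -> R :=
  ball_fun (expR (-1)) (diag_mx (axial (2 / 3) 1)) (vcons (- (1 / 3)) 0).

Lemma is_john_cyl_ex : is_john cyl_ex john_cyl_ex.
Proof.
exists (expR (-1)), (diag_mx (axial (2 / 3) 1)), (vcons (- (1 / 3)) 0); split => //.
have p23 : 0 < 2 / 3 :> R by lra.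
apply: john_optimalI => [x||||].
- exact: trunc_exp_ge0.
- exact: expR_ge0.
- by apply: unitmx_diag; apply: axial_gt0.
- move=> u u1; rewrite /cyl_ex /trunc_exp /tail_ball aff_axial0 tl_aff_axial scale1r.
  have := norm2_coord u 0; have := norm2_tl_le u => h1 h2.
  rewrite ifT; last exact: le_trans u1.
  rewrite ler_expR lerN2 /hgt.
  have : `|u 0 0| <= 1 by exact: le_trans u1.
  rewrite ler_norml => /andP[h3 h4].
  by have [q|q] := lerP 0 (2 / 3 * u 0 0 - 1 / 3); [rewrite ger0_norm|rewrite ltr0_norm]; lra.
- move=> s T a s0 uT /(trunc_exp_ball s0) h.
  rewrite det_axial// expr1n mulr1.
  have ri i : norm2 (row (lift ord0 i) T)^T <= 1.
    apply: (@norm2_row_le _ _ _ a _ 0) => u /h[+ _]; rewrite subr0.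
    exact/le_trans/coord_le_norm2_tl.
  have := prod_le_axial (fun i => norm2_ge0 (row i T)^T) (lexx _) ri.
  have := det_le_prod_rows T; rewrite expr1n mulr1 => d1 d2.
  set r := norm2 _ in d2; have {d1 d2}dr := le_trans d1 d2.
  (* With center c and half-width r, h(c + r) >= 3 (c + r) and h(c - r) >= r - c. Weighted by 1/4
     and 3/4 these bounds give 3r/2, so one endpoint has h >= 3r/2. *)
  have sr : s <= expR (- (3 / 2 * r)).
    have [u u1 uE] := exists_extreme T ord0.
    have [_ h1] := h u u1; have [|_] := h (- u); rewrite ?norm2N//.
    move: h1; rewrite /aff mulmxN !mxE; move: uE; rewrite mxE -/r => -> h1 h2.
    set c := a 0 0 in h1 h2.
    have [l1|l1] := lerP (3 / 2 * r) (3 * (r + c)).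
      apply: le_trans h1 _; rewrite ler_expR lerN2 /hgt.
      by have := ler_norm (r + c); lra.
    apply: le_trans h2 _; rewrite ler_expR lerN2 /hgt.
    by have := ler_norm (- (- r + c)); rewrite normrN; lra.
  have r0 : 0 <= r by exact: norm2_ge0.
  have : 3 / 2 * r <= expR (3 / 2 * r - 1).
    by have := expR_ge1Dx (3 / 2 * r - 1); rewrite addrCA subrr addr0.
  rewrite expRD; move: sr; rewrite expRN.
  have := expR_gt0 (3 / 2 * r); have := expR_gt0 (-1 : R).
  move: (expR (3 / 2 * r)) (expR (-1)) => B A A0 B0 sB rA.
  apply: (@le_trans _ _ (s * r)); first by rewrite ler_wpM2l// ltW.
  apply: (@le_trans _ _ (B^-1 * r)); first by rewrite ler_wpM2r.
  rewrite ler_pdivrMl//; lra.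
Qed.

Lemma loewner_polar_cyl_ex_neq :
  cone_fun (diag_mx E) (vcons (- (1 / 2)) 0) 1 <> polar 0 john_cyl_ex.
Proof.
move=> /(congr1 (fun F : V -> R => F 0)).
rewrite /john_cyl_ex ball_funE ?expR_gt0// expRK opprK.
set S := fun _ => _.
have := @polar_trunc_exp_ge R m.+1 0 0 S (fun=> 1) (-1).
move=> hp h; have : expR (- -1) <= cone_fun (diag_mx E) (vcons (- (1 / 2)) 0) 1 (0 : V).
  rewrite h; apply: hp => [|x _]; last by rewrite !subr0 dotC dot0l; lra.
  exists (aff (diag_mx (axial (2 / 3) 1)) (vcons (- (1 / 3)) 0) 0); apply/asboolP; exists 0 => //.
  by rewrite /unit_ball/= norm2_0.
rewrite opprK /cone_fun ler_expR /aff mulmx0 add0r norm2_vcons0 normrN ger0_norm; lra.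
Qed.

End SecondCounterexample.

(** * Dimension one *)

Section OneDim.
Context {R : realType}.
Notation V := 'cV[R]_1.

Lemma dot1 (x y : V) : dot x y = x 0 0 * y 0 0.
Proof. by rewrite /dot big_ord1. Qed.

Lemma norm2_1 (x : V) : norm2 x = `|x 0 0|.
Proof. by rewrite /norm2 dot1 -expr2 sqrtr_sqr. Qed.

Lemma aff1 (T : 'M[R]_1) (a x : V) : aff T a x 0 0 = T 0 0 * x 0 0 + a 0 0.
Proof. by rewrite /aff !mxE big_ord1. Qed.

Lemma diag_const1 (d : R) : diag_mx (const_mx d : 'rV[R]_1) = d%:M.
Proof. exact: diag_const_mx. Qed.

Lemma mx11_diag (T : 'M[R]_1) : T = diag_mx (const_mx (T 0 0) : 'rV[R]_1).
Proof. by rewrite diag_const1; exact: mx11_scalar. Qed.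

Lemma unitmx1 (T : 'M[R]_1) : (T \in unitmx) = (T 0 0 != 0).
Proof. by rewrite unitmxE det_mx11 unitfE. Qed.

Lemma cone_fun1 (T : 'M[R]_1) a t x :
  cone_fun T a t x = expR (- `|T 0 0 * x 0 0 + a 0 0| + t).
Proof. by rewrite /cone_fun norm2_1 aff1. Qed.

Lemma trunc_exp_le_cone1 (p : R -> R) (T : 'M[R]_1) a t :
  (forall x, trunc_exp predT (fun x : V => p (x 0 0)) x <= cone_fun T a t x) <->
  (forall u, `|T 0 0 * u + a 0 0| <= p u + t).
Proof.
split=> [/trunc_exp_le_cone h u|h].
  by have := h u%:M isT; rewrite norm2_1 aff1 mxE eqxx mulr1n.
by apply/trunc_exp_le_cone => x _; rewrite norm2_1 aff1.
Qed.

Lemma prod_norm2_col1 (T : 'M[R]_1) : \prod_i norm2 (col i T) = `|T 0 0|.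
Proof. by rewrite big_ord1 norm2_1 mxE. Qed.

(** Replacing (T, a) by (-T, -a) leaves the cone unchanged, so only positive slopes need to be
    compared. *)
Lemma is_loewner1 (p : R -> R) (tau alpha t : R) : 0 < tau ->
  (forall u, `|tau * u + alpha| <= p u + t) ->
  (forall tau' alpha' t', 0 < tau' ->
    (forall u, `|tau' * u + alpha'| <= p u + t') -> expR t / tau <= expR t' / tau') ->
  is_loewner (trunc_exp predT (fun x : V => p (x 0 0)))
    (cone_fun tau%:M alpha%:M t) (- (alpha / tau))%:M.
Proof.
move=> tau0 feas opt.
have -> : (- (alpha / tau))%:M = - (invmx tau%:M *m (alpha%:M : V)).
  rewrite invmx_scalar mul_scalar_mx; apply/colP => i.
  by rewrite !mxE !ord1 eqxx !mulr1n mulrC.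
rewrite -diag_const1; apply: is_loewner_diag => [x|i||T' a' t' uT].
- exact: trunc_exp_ge0.
- by rewrite mxE.
- by apply/trunc_exp_le_cone1 => u; rewrite diag_const1 !mxE eqxx !mulr1n.
move=> /trunc_exp_le_cone1 h.
rewrite big_ord1 mxE prod_norm2_col1.
move: uT; rewrite unitmx1 => T0.
have [Tp|Tn|Te] := ltgtP 0 (T' 0 0); last by rewrite -Te eqxx in T0.
  by rewrite gtr0_norm//; apply: (opt _ (a' 0 0)).
rewrite ltr0_norm//; apply: (opt _ (- a' 0 0)); first by rewrite oppr_gt0.
by move=> u; rewrite mulNr -opprD normrN.
Qed.

(** In dimension one both integrals are known up to the mass, which is positive and finite and
    cancels. This is how optimality of an unknown cone is exploited. *)
Lemma loewner_optimal1_le (f : V -> R) (T T' : 'M[R]_1) a t a' t' : (forall x, 0 <= f x) ->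
  0 < T 0 0 -> 0 < T' 0 0 -> loewner_optimal f T a t -> loewner_feasible f T' a' t' ->
  expR t / T 0 0 <= expR t' / T' 0 0.
Proof.
move=> f0 T0 T'0 [_ opt] /opt; rewrite (mx11_diag T) (mx11_diag T').
rewrite !integral_cone_diag => [|i|i]; rewrite ?mxE//.
rewrite !big_ord1 !mxE lee_pmul2r ?lee_fin ?cone_mass1_gt0//.
by rewrite ge0_fin_numE ?cone_mass_ge0// cone_mass_fin.
Qed.

(** The tangent to ln at tau gives ln tau' - ln tau <= (tau' - tau) / tau. Optimality of a cone thus
    becomes a polynomial inequality. *)
Lemma expR_div_le_tangent (tau tau' t t' : R) : 0 < tau -> 0 < tau' ->
  (tau' - tau) / tau <= t' - t -> expR t / tau <= expR t' / tau'.
Proof.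
move=> t0 t'0 h; rewrite ler_pdivlMr// mulrAC ler_pdivrMr//.
rewrite -(subrK t t') expRD mulrAC [leLHS]mulrC ler_pM2r ?expR_gt0//.
rewrite -ler_pdivrMr//; apply: le_trans (expR_ge1Dx _).
apply: le_trans (_ : 1 + (tau' - tau) / tau <= _); last by rewrite lerD2l.
by rewrite mulrBl divff ?gt_eqF// addrCA subrr addr0.
Qed.

Lemma polar1_supremum (psi : R -> R) (z y : V) u :
  (forall v, (v - z 0 0) * (y 0 0 - z 0 0) - psi v
    <= (u - z 0 0) * (y 0 0 - z 0 0) - psi u) ->
  polar z (trunc_exp predT (fun x : V => psi (x 0 0))) y
  = expR (- ((u - z 0 0) * (y 0 0 - z 0 0) - psi u)).
Proof.
move=> h.
have E v : dot ((v%:M : V) - z) (y - z) - psi ((v%:M : V) 0 0) =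
    (v - z 0 0) * (y 0 0 - z 0 0) - psi v.
  by rewrite dot1 !mxE eqxx mulr1n.
rewrite -E; apply: polar_trunc_exp => // x _; rewrite E.
by have := h (x 0 0); rewrite dot1 !mxE.
Qed.

Lemma ball1_interval (T : 'M[R]_1) a (x : V) :
  (aff T a @` unit_ball) x <->
  a 0 0 - `|T 0 0| <= x 0 0 <= a 0 0 + `|T 0 0|.
Proof.
split=> [[u u1 <-]|].
  move: u1; rewrite /unit_ball/= norm2_1 aff1 => u1.
  have : `|T 0 0 * u 0 0| <= `|T 0 0| by rewrite normrM ler_piMr.
  by rewrite ler_norml => /andP[h1 h2]; apply/andP; split; lra.
move=> /andP[h1 h2].
have [T0|T0] := eqVneq (T 0 0) 0.
  exists 0; rewrite /unit_ball/= ?norm2_0 ?ler01//.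
  apply/colP => i; rewrite !ord1 aff1 T0 mul0r add0r.
  by move: h1 h2; rewrite T0 normr0 => h1 h2; apply/eqP; rewrite eq_le; apply/andP; split; lra.
exists ((x 0 0 - a 0 0) / T 0 0)%:M.
  rewrite /unit_ball/= norm2_1 mxE eqxx mulr1n normf_div ler_pdivrMr ?normr_gt0// mul1r.
  by rewrite ler_norml; apply/andP; split; lra.
by apply/colP => i; rewrite !ord1 aff1 mxE eqxx mulr1n mulrC divfK ?subrK.
Qed.

Lemma john_endpoints (phi : R -> R) s (T : 'M[R]_1) a :
  (forall u : V, norm2 u <= 1 -> s <= phi (aff T a u 0 0)) ->
  s <= phi (a 0 0 - `|T 0 0|) /\ s <= phi (a 0 0 + `|T 0 0|).
Proof.
move=> h; split.
  have [//|u u1 uE] := (ball1_interval T a (a 0 0 - `|T 0 0|)%:M).2.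
    by rewrite mxE eqxx mulr1n lexx/= lerD2l -subr_ge0 opprK addr_ge0.
  by have := h u u1; rewrite uE mxE eqxx mulr1n.
have [//|u u1 uE] := (ball1_interval T a (a 0 0 + `|T 0 0|)%:M).2.
  by rewrite mxE eqxx mulr1n lexx andbT lerD2l -subr_ge0 opprK addr_ge0.
by have := h u u1; rewrite uE mxE eqxx mulr1n.
Qed.

Lemma is_john1 (phi : R -> R) s l a : (forall u, 0 < phi u) -> 0 <= s -> 0 < l ->
  (forall u, a - l <= u <= a + l -> s <= phi u) ->
  (forall s' l' a', 0 < s' -> 0 < l' -> s' <= phi (a' - l') -> s' <= phi (a' + l') ->
    s' * l' <= s * l) ->
  john_optimal (fun x : V => phi (x 0 0)) s l%:M a%:M.
Proof.
move=> phi0 s0 l0 h opt.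
have lE : (l%:M : 'M[R]_1) 0 0 = l by rewrite mxE eqxx mulr1n.
have aE : (a%:M : V) 0 0 = a by rewrite mxE eqxx mulr1n.
apply: john_optimalI => [x|||u u1|s' T' a' s'0 uT h'] //.
- exact: ltW.
- by rewrite unitmx1 lE gt_eqF.
- apply: h; have : (aff l%:M a%:M @` unit_ball) (aff l%:M a%:M u) by exists u.
  by move/ball1_interval; rewrite lE aE gtr0_norm.
rewrite !det_mx11 lE (gtr0_norm l0).
have [h1 h2] := john_endpoints h'.
by apply: (opt _ _ (a' 0 0)) => //; rewrite normr_gt0 -unitmx1.
Qed.

Lemma john_optimal1_le (phi : R -> R) s T a s' l' a' :
  (forall u, 0 < phi u) -> 0 < l' ->
  john_optimal (fun x : V => phi (x 0 0)) s T a ->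
  (forall u, a' - l' <= u <= a' + l' -> s' <= phi u) -> s' * l' <= s * `|T 0 0|.
Proof.
move=> phi0 l0 [_ opt] h; rewrite -(det_mx11 T).
have lE : (l'%:M : 'M[R]_1) 0 0 = l' by rewrite mxE eqxx mulr1n.
have -> : l' = `|\det (l'%:M : 'M[R]_1)| by rewrite det_mx11 lE gtr0_norm.
apply: (opt _ _ a'%:M); apply: john_feasibleI => [x||u u1]; first exact: ltW.
  by rewrite unitmx1 lE gt_eqF.
apply: h; have : (aff l'%:M a'%:M @` unit_ball) (aff l'%:M a'%:M u) by exists u.
by move/ball1_interval; rewrite lE gtr0_norm// mxE eqxx mulr1n.
Qed.

(** By quasiconcavity the best height over [p, q] is the smaller end value, so a continuous function
    of (p, q) is maximized on a compact square. An interval leaving the square scores at most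
    [kappa], which [-r0, r0] already reaches. *)
Lemma exists_john1 (phi : R -> R) (M kappa r0 : R) :
  (forall u, 0 < phi u) -> continuous phi ->
  (forall p q u, p <= u <= q -> Num.min (phi p) (phi q) <= phi u) ->
  0 < r0 <= M -> (forall u, M <= `|u| -> phi u * `|u| <= kappa) ->
  kappa <= phi (- r0) * r0 -> kappa <= phi r0 * r0 ->
  exists s l a, 0 < l /\ john_optimal (fun x : V => phi (x 0 0)) s l%:M a%:M.
Proof.
move=> phi0 cphi qphi /andP[r00 r0M] tail kl kr.
pose A : set (R * R) := `[- M, M] `*` `[- M, M].
pose G (x : R * R) := Num.min (phi x.1) (phi x.2) * ((x.2 - x.1) / 2).
have cA : compact A by apply: compact_setX; exact: segment_compact.
have inM (u : R) : `|u| <= M -> `[- M, M]%classic u.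
  by rewrite ler_norml /= in_itv/=.
have Ar : A (- r0, r0) by split; apply: inM; rewrite ?normrN ger0_norm// ltW.
have cG : {within A, continuous G}.
  apply: continuous_subspaceT => x.
  have c1 : {for x, continuous (phi \o @fst R R)}.
    by apply: continuous_comp; [exact: cvg_fst|exact: cphi].
  have c2 : {for x, continuous (phi \o @snd R R)}.
    by apply: continuous_comp; [exact: cvg_snd|exact: cphi].
  apply: cvgM; first exact: (continuous_min c1 c2).
  by apply: cvgM; [apply: cvgB; [exact: cvg_snd|exact: cvg_fst]|exact: cvg_cst].
have [[p q] _ maxG] := compact_EVT_max (ex_intro _ _ Ar) cA cG.
have Gr0 : kappa <= G (p, q).
  apply: le_trans (maxG _ (mem_set Ar)); rewrite /G/= (_ : (r0 - - r0) / 2 = r0); last by lra.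
  by case: (leP (phi (- r0))).
have G0 : 0 < G (p, q).
  apply: lt_le_trans (maxG _ (mem_set Ar)); rewrite /G/= mulr_gt0//.
    by rewrite lt_min !phi0.
  by rewrite divr_gt0// opprK addr_gt0.
have s0 : 0 < Num.min (phi p) (phi q) by rewrite lt_min !phi0.
exists (Num.min (phi p) (phi q)), ((q - p) / 2), ((p + q) / 2).
have l0 : 0 < (q - p) / 2 by move: G0; rewrite /G/= pmulr_rgt0.
split=> //; apply: is_john1 => //; first exact: ltW.
  by move=> u h; apply: qphi; move: h => /andP[h1 h2]; apply/andP; split; lra.
move=> s' l' a' s'0 l'0 h1 h2; rewrite -/(G (p, q)).
have [b|b] := boolP ((`|a' - l'| <= M) && (`|a' + l'| <= M)).
  move: b => /andP[b1 b2].
  apply: le_trans (maxG (a' - l', a' + l') (mem_set _)); last by split; exact: inM.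
  rewrite /G/= (_ : (a' + l' - (a' - l')) / 2 = l'); last by lra.
  by apply: ler_wpM2r; [exact: ltW | rewrite le_min h1].
apply: le_trans Gr0.
(* The endpoint u of larger absolute value lies outside [-M, M], and l' <= |u|, so the tail bound at
   u applies. *)
have [c|c] := lerP `|a' - l'| `|a' + l'|.
  have Mu : M <= `|a' + l'|.
    rewrite leNgt; apply: contra b => u; apply/andP; split; last exact: ltW.
    exact: le_trans c (ltW u).
  apply: le_trans (tail _ Mu); apply: ler_pM => //; [exact: ltW..|].
  by move: c; rewrite !ler_norml; have := ler_norm (a' + l');
    have := ler_norm (l' - a'); rewrite distrC; lra.
have Mu : M <= `|a' - l'|.
  rewrite leNgt; apply: contra b => u; apply/andP; split; first exact: ltW.
  exact: le_trans (ltW c) (ltW u).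
apply: le_trans (tail _ Mu); apply: ler_pM => //; [exact: ltW..|].
by move: c; have := ler_norm (a' + l'); have := ler_norm (l' - a'); rewrite distrC; lra.
Qed.

End OneDim.

(** * The one-dimensional example *)

Section LoewnerExample.
Context {R : realType}.
Notation V := 'cV[R]_1.
Notation b := (@center_ex R).
Notation sqrt5 := (Num.sqrt 5 : R).

Lemma sqrt5_gt0 : 0 < sqrt5. Proof. by rewrite sqrtr_gt0. Qed.
Lemma sqr_sqrt5 : sqrt5 ^+ 2 = 5. Proof. by rewrite sqr_sqrtr. Qed.

(** The bounds of [psi_ex_cone_bound] add up to t >= 5 tau^2 / 32, and 5 tau^2 / 32 - ln tau is
    least at tau^2 = 16/5, where t = 1/2. Equality in both bounds gives alpha = -3/10. *)
Definition slope : R := 4 / sqrt5.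

Lemma slope_gt0 : 0 < slope. Proof. by rewrite divr_gt0// sqrt5_gt0. Qed.

Lemma sqr_slope : slope ^+ 2 = 16 / 5.
Proof. by rewrite expr_div_n sqr_sqrt5; congr (_ / _); ring. Qed.

Lemma center_ex_gt0 : 0 < b.
Proof. by rewrite /center_ex divr_gt0// mulr_gt0// sqrt5_gt0. Qed.

Lemma sqr_center_ex : b ^+ 2 = 9 / 320.
Proof. by rewrite /center_ex expr_div_n exprMn sqr_sqrt5; field. Qed.

Lemma slope_center : slope * b = 3 / 10.
Proof.
rewrite /slope /center_ex mulf_div; have := sqr_sqrt5; have := sqrt5_gt0.
move: sqrt5 => s s0 s2; rewrite mulrCA -expr2 s2; lra.
Qed.

Lemma center_ex_lt : b < 1 / 4.
Proof. by have := center_ex_gt0; have := sqr_center_ex; nra. Qed.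

Lemma f_exE : @f_ex R = trunc_exp predT (fun x : V => psi_ex (x 0 0)).
Proof. by []. Qed.

Lemma psi_exP (u : R) : psi_ex u = 5 / 2 * u ^+ 2 - 3 / 2 * (u * `|u|).
Proof.
rewrite /psi_ex; have [u0|u0] := leP u 0.
  by rewrite ler0_norm//; lra.
by rewrite gtr0_norm//; lra.
Qed.

Lemma psi_ex_pos (u : R) : 0 <= u -> psi_ex u = u ^+ 2.
Proof. by move=> u0; rewrite psi_exP ger0_norm//; lra. Qed.

Lemma psi_ex_neg (u : R) : u <= 0 -> psi_ex u = 4 * u ^+ 2.
Proof. by rewrite /psi_ex => ->. Qed.

(** Supporting lines give convexity at once and avoid sign cases on three points. *)
Lemma psi_ex_subgradient (z : R) : exists g, forall u, psi_ex z + g * (u - z) <= psi_ex u.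
Proof.
have [z0|z0] := leP z 0.
  exists (8 * z) => u; rewrite (psi_ex_neg z0).
  have [u0|/ltW u0] := leP u 0.
    by rewrite psi_ex_neg//; have := sqr_ge0 (u - z); lra.
  rewrite psi_ex_pos//; have := sqr_ge0 z; have := sqr_ge0 u.
  by have : z * u <= 0 by [rewrite mulr_le0_ge0]; lra.
have {}z0 := ltW z0; exists (2 * z) => u; rewrite (psi_ex_pos z0).
have [u0|/ltW u0] := leP u 0.
  rewrite psi_ex_neg//; have := sqr_ge0 z; have := sqr_ge0 u.
  by have : z * u <= 0 by [rewrite mulr_ge0_le0]; lra.
by rewrite psi_ex_pos//; have := sqr_ge0 (u - z); lra.
Qed.

Lemma psi_ex_convex (l u v : R) : 0 <= l -> l <= 1 ->
  psi_ex (l * u + (1 - l) * v) <= l * psi_ex u + (1 - l) * psi_ex v.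
Proof.
move=> l0 l1; have [g h] := psi_ex_subgradient (l * u + (1 - l) * v).
have l1' : 0 <= 1 - l by rewrite subr_ge0.
have := ler_wpM2l l0 (h u); have := ler_wpM2l l1' (h v).
move: (psi_ex _) (psi_ex u) (psi_ex v) => A B C; lra.
Qed.

Lemma f_ex_ge0 (x : V) : 0 <= f_ex x. Proof. exact: expR_ge0. Qed.

Lemma loewner_exE : @loewner_ex R = cone_fun slope%:M (- (slope * b))%:M (1 / 2).
Proof.
apply/funext => x; rewrite cone_fun1 !mxE eqxx !mulr1n -mulrBr normrM.
by rewrite (gtr0_norm slope_gt0).
Qed.

Lemma loewner_ex_feasible (u : R) : `|slope * u - slope * b| <= psi_ex u + 1 / 2.
Proof.
rewrite slope_center; have := sqr_slope; have := slope_gt0.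
move: slope => s s0 s2; rewrite ler_norml.
have [u0|/ltW u0] := leP u 0.
  have su : s * u <= 0 by rewrite mulr_ge0_le0// ltW.
  rewrite psi_ex_neg//; have := sqr_ge0 (2 * u + s / 4); have := sqr_ge0 u.
  by lra.
have su : 0 <= s * u by rewrite mulr_ge0// ltW.
rewrite psi_ex_pos//; have := sqr_ge0 (u - s / 2); have := sqr_ge0 u.
by lra.
Qed.

(** The points tau/2 and -tau/8 minimize [psi_ex u] - tau u and [psi_ex u] + tau u, so they are the
    most restrictive tests. *)
Lemma psi_ex_cone_bound (tau alpha t : R) : 0 < tau ->
  (forall u, `|tau * u + alpha| <= psi_ex u + t) ->
  tau ^+ 2 / 4 + alpha <= t /\ tau ^+ 2 / 16 - alpha <= t.
Proof.
move=> tau0 h; split.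
  have := h (tau / 2); rewrite psi_ex_pos; last by rewrite divr_ge0// ltW.
  by rewrite ler_norml => /andP[_]; lra.
have := h (- (tau / 8)); rewrite psi_ex_neg; last by rewrite oppr_le0 divr_ge0// ltW.
by rewrite ler_norml => /andP[+ _]; lra.
Qed.

Lemma is_loewner_ex : is_loewner (@f_ex R) loewner_ex b%:M.
Proof.
rewrite loewner_exE f_exE.
have -> : b%:M = (- (- (slope * b) / slope))%:M :> V.
  by rewrite mulNr opprK mulrAC divff ?mul1r// gt_eqF// slope_gt0.
apply: is_loewner1; first exact: slope_gt0.
  exact: loewner_ex_feasible.
move=> tau alpha t tau0 /(psi_ex_cone_bound tau0)[h1 h2].
apply: expR_div_le_tangent => //; first exact: slope_gt0.
rewrite ler_pdivrMr ?slope_gt0//.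
have := sqr_slope; have := slope_gt0.
move: slope => s s0 s2.
have : 0 <= (tau - s) ^+ 2 * s by rewrite mulr_ge0 ?sqr_ge0// ltW.
have : (tau ^+ 2 * 5 / 32) * s <= t * s by rewrite ler_pM2r//; lra.
nra.
Qed.

Lemma admissible_ex : admissible (@f_ex R).
Proof.
rewrite f_exE; split.
- apply: log_concave_trunc_exp => l x y l0 l1 _ _; split=> //.
  by rewrite !mxE; exact: psi_ex_convex.
- have s0 i : 0 < (const_mx slope : 'rV[R]_1) 0 i by rewrite mxE slope_gt0.
  apply: le_lt_trans (integral_cone_diag_fin (- (slope * b))%:M (1 / 2) s0).
  apply: le_integral_Rn => [x|]; first exact: trunc_exp_ge0.
  apply/trunc_exp_le_cone1 => u; rewrite diag_const1 !mxE eqxx !mulr1n.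
  exact: loewner_ex_feasible.
- by apply: interior_setT_nonempty => x; rewrite /supp/= trunc_exp_neq0.
Qed.

Lemma sym_posdef1 (T : 'M[R]_1) : sym_posdef T -> 0 < T 0 0.
Proof.
move=> [_ /(_ (const_mx 1))]; rewrite dot1 !mxE big_ord1 !mxE mul1r mulr1; apply.
by apply/eqP => /colP/(_ 0); rewrite !mxE => /eqP; rewrite oner_eq0.
Qed.

(** Comparison with the explicit cone reverses the optimality inequality and forces (T - slope)^2 <=
    0; the two cone bounds then fix t and a. Positive definiteness settles the sign of T. *)
Lemma is_loewner_ex_unique g c : is_loewner (@f_ex R) g c ->
  g = loewner_ex /\ c = b%:M.
Proof.
move=> [T [a [t [/sym_posdef1 T0 opt gE cE]]]].
have [[uT h] _] := opt.
have feas : loewner_feasible f_ex slope%:M (- (slope * b))%:M (1 / 2).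
  apply/loewner_feasibleP; first exact: f_ex_ge0.
  split; first by rewrite unitmx1 mxE eqxx mulr1n gt_eqF// slope_gt0.
  apply/(trunc_exp_le_cone1 psi_ex) => u; rewrite !mxE eqxx !mulr1n.
  exact: loewner_ex_feasible.
have sE : (slope%:M : 'M[R]_1) 0 0 = slope by rewrite mxE eqxx mulr1n.
have := loewner_optimal1_le f_ex_ge0 T0 _ opt feas.
rewrite sE => /(_ slope_gt0) le1.
have /loewner_feasibleP[|_] := opt.1; first exact: f_ex_ge0.
move=> /(trunc_exp_le_cone1 psi_ex)/(psi_ex_cone_bound T0)[h1 h2].
have s0 := slope_gt0; have s2 := sqr_slope.
have tE : t = 1 / 2 /\ T 0 0 = slope.
  move: le1; rewrite ler_pdivrMr// mulrAC ler_pdivlMr//.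
  rewrite -{1}(subrK (1 / 2) t) expRD mulrAC [leRHS]mulrC ler_pM2r ?expR_gt0// => le1.
  have := expR_ge1Dx (t - 1 / 2) => e1.
  have {}le1 : (1 + (t - 1 / 2)) * slope <= T 0 0.
    by apply: le_trans le1; rewrite ler_pM2r.
  have {}le1 : (1 / 2 + (T 0 0) ^+ 2 * 5 / 32) * slope <= T 0 0.
    by apply: le_trans le1; rewrite ler_pM2r//; lra.
  have {}le1 : (T 0 0 - slope) ^+ 2 <= 0.
    move: le1 s0 s2 T0; move: slope (T 0 0) => s u le1 s0 s2 u0.
    have := ler_wpM2r (ltW s0) le1; nra.
  have TE : T 0 0 = slope.
    by apply/eqP; rewrite -subr_eq0 -sqrf_eq0 eq_le le1 sqr_ge0.
  split=> //; apply/eqP; rewrite eq_le; apply/andP; split.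
    have := loewner_optimal1_le f_ex_ge0 T0 _ opt feas.
    by rewrite sE => /(_ slope_gt0); rewrite TE ler_pM2r ?invr_gt0// ler_expR.
  by move: h1 h2; rewrite TE; lra.
have [t_eq TE] := tE; rewrite {}t_eq in h1 h2 gE.
have aE : a = (- (slope * b))%:M.
  apply/colP => i; rewrite !ord1 [RHS]mxE eqxx mulr1n slope_center.
  by apply/eqP; rewrite eq_le; move: h1 h2; rewrite TE s2 => h1 h2; apply/andP; split; lra.
have {}TE : T = slope%:M by rewrite [LHS]mx11_scalar TE.
rewrite gE cE TE aE loewner_exE; split=> //.
rewrite invmx_scalar mul_scalar_mx; apply/colP => i.
by rewrite !mxE !ord1 eqxx !mulr1n mulrN opprK mulKf// gt_eqF.
Qed.

Lemma polar_loewner_exE : polar b%:M (@loewner_ex R) = polar_loewner_ex.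
Proof.
have bE : (b%:M : V) 0 0 = b by rewrite mxE eqxx mulr1n.
have -> : @loewner_ex R = trunc_exp predT (fun x : V => slope * `|x 0 0 - b| - 1 / 2).
  by apply/funext => x; rewrite /trunc_exp/= opprB addrC.
apply/funext => y; rewrite /polar_loewner_ex -/slope indicE.
have s0 := slope_gt0.
case: (boolP (`|y 0 0 - b| <= slope)) => hy.
  rewrite mem_set; last first.
    by move: hy; rewrite ler_norml => /andP[h1 h2]; apply/andP; split; lra.
  rewrite mulr1 (@polar1_supremum _ (fun u => slope * `|u - b| - 1 / 2) _ _ b) => [|v].
    by congr expR; rewrite bE subrr normr0; lra.
  rewrite bE subrr normr0 mul0r mulr0.
  have : (v - b) * (y 0 0 - b) <= `|v - b| * slope.
    apply: le_trans (ler_norm _) _; rewrite normrM; exact: ler_wpM2l.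
  lra.
rewrite memNset => [|/= /andP[h1 h2]]; last first.
  by move: hy; rewrite ler_norml => /negP; apply; apply/andP; split; lra.
rewrite mulr0; apply: polar_trunc_exp_eq0 => M.
rewrite -ltNge in hy; set w := y 0 0 - b in hy.
have d0 : 0 < `|w| - slope by rewrite subr_gt0.
pose r := `|M| / (`|w| - slope).
have r0 : 0 <= r by rewrite divr_ge0// ltW.
have rM : r * (`|w| - slope) = `|M| by rewrite divfK ?gt_eqF.
(* Moving away from b in the direction of w gains r (|w| - slope) = |M|. *)
exists (b + r * Num.sg w)%:M => //.
rewrite dot1 !mxE eqxx !mulr1n -/w addrAC subrr add0r -mulrA -normrEsg.
rewrite normrM normr_sg (ger0_norm r0).
have -> : (w != 0)%:R = 1 :> R.
  by rewrite (_ : w != 0)// -normr_gt0 (lt_trans s0).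
by have := ler_norm M; rewrite -rM; lra.
Qed.

End LoewnerExample.

(** * The polar of the one-dimensional example and its John function *)

Section Dual.
Context {R : realType}.
Notation V := 'cV[R]_1.
Notation b := (@center_ex R).
Notation slope := (@slope R).

(** The Legendre transform of [psi_ex] with respect to b, as a function of w = y - b. The term w |w|
    merges the two branches w^2/4 and w^2/16. *)
Definition theta (w : R) : R := 5 / 32 * w ^+ 2 + 3 / 32 * (w * `|w|) - b * w.

Lemma theta_pos w : 0 <= w -> theta w = w ^+ 2 / 4 - b * w.
Proof. by move=> w0; rewrite /theta ger0_norm//; lra. Qed.

Lemma theta_neg w : w <= 0 -> theta w = w ^+ 2 / 16 - b * w.
Proof. by move=> w0; rewrite /theta ler0_norm//; lra. Qed.

Lemma theta_ub u w : (u - b) * w - psi_ex u <= theta w.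
Proof.
have [w0|/ltW w0] := leP w 0; [rewrite theta_neg//|rewrite theta_pos//];
  (have [u0|/ltW u0] := leP u 0; [rewrite psi_ex_neg//|rewrite psi_ex_pos//]).
- by have := sqr_ge0 (2 * u - w / 4); lra.
- by have := sqr_ge0 u; have := sqr_ge0 w; have : u * w <= 0 by [rewrite mulr_ge0_le0]; lra.
- by have := sqr_ge0 u; have := sqr_ge0 w; have : u * w <= 0 by [rewrite mulr_le0_ge0]; lra.
- by have := sqr_ge0 (u - w / 2); lra.
Qed.

Lemma theta_attained w : exists u, theta w = (u - b) * w - psi_ex u.
Proof.
have [w0|/ltW w0] := leP w 0.
  exists (w / 8); rewrite theta_neg// psi_ex_neg; first by lra.
  by rewrite pmulr_lle0// invr_gt0.
exists (w / 2); rewrite theta_pos// psi_ex_pos; first by lra.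
by rewrite divr_ge0.
Qed.

Definition dual (u : R) : R := expR (- theta (u - b)).

Lemma polar_f_ex : polar b%:M (@f_ex R) = fun y : V => dual (y 0 0).
Proof.
apply/funext => y; rewrite f_exE /dual.
have bE : (b%:M : V) 0 0 = b by rewrite mxE eqxx mulr1n.
have [u uE] := theta_attained (y 0 0 - b).
rewrite (@polar1_supremum _ psi_ex _ _ u) bE -?uE// => v.
exact: theta_ub.
Qed.

(** The affine function that attains the supremum at w is monotone, so its value at p or at q is no
    smaller, and [theta] lies above it. *)
Lemma theta_quasiconvex p q w : p <= w <= q -> theta w <= Num.max (theta p) (theta q).
Proof.
move=> /andP[pw wq]; have [u uE] := theta_attained w.
have hp := theta_ub u p; have hq := theta_ub u q.
rewrite le_max; have [ub|ub] := leP 0 (u - b); apply/orP; [right|left].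
  by apply: le_trans hq; rewrite uE lerD2r ler_wpM2l.
by apply: le_trans hp; rewrite uE lerD2r ler_wnM2l// ltW.
Qed.

Lemma dual_gt0 u : 0 < dual u. Proof. exact: expR_gt0. Qed.

Lemma dual_quasiconcave p q u : p <= u <= q -> Num.min (dual p) (dual q) <= dual u.
Proof.
move=> puq; have : p - b <= u - b <= q - b by rewrite !lerD2r.
move/theta_quasiconvex; rewrite le_max ge_min /dual !ler_expR !lerN2.
by case/orP => ->; rewrite ?orbT.
Qed.

Lemma continuous_theta : continuous theta.
Proof.
move=> w; apply: cvgB; last by apply: cvgM; [exact: cvg_cst|exact: cvg_id].
apply: cvgD; apply: cvgM; try exact: cvg_cst.
  by apply: cvgM; exact: cvg_id.
by apply: cvgM; [exact: cvg_id|exact: norm_continuous].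
Qed.

Lemma continuous_dual : continuous dual.
Proof.
move=> u; apply: (@continuous_comp _ _ _ (fun u => - theta (u - b)) expR).
  apply: cvgN; apply: (@continuous_comp _ _ _ (fun u => u - b) theta).
    by apply: cvgB; [exact: cvg_id|exact: cvg_cst].
  exact: continuous_theta.
exact: continuous_expR.
Qed.

(** It suffices that 4 |u| <= 1 + theta. The slower branch is w^2/16, and 70/16 > 4. *)
Lemma dual_tail u : 70 <= `|u| -> dual u * `|u| <= 1 / 4.
Proof.
move=> u70; rewrite /dual expRN mulrC ler_pdivrMr ?expR_gt0//.
suff h : 4 * `|u| <= 1 + theta (u - b) by have := expR_ge1Dx (theta (u - b)); lra.
have := @center_ex_lt R; have := @center_ex_gt0 R; move: u70; rewrite /theta.
move: b => c u70 c0 c1.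
have [u0|u0] := leP u 0.
  move: u70; rewrite (ler0_norm u0) ler0_norm; last by lra.
  by move=> u70; nra.
move: u70; rewrite (gtr0_norm u0) => u70.
by rewrite ger0_norm; last lra; nra.
Qed.

Lemma exists_john_dual : exists s l a, 0 < l /\
  john_optimal (fun x : V => dual (x 0 0)) s l%:M a%:M.
Proof.
have c1 := @center_ex_lt R; have c0 := @center_ex_gt0 R.
have lb w : theta w <= 1 / 4 -> 1 / 4 <= expR (- theta w) * (1 / 2).
  by move=> h; have := expR_ge1Dx (- theta w); lra.
apply: (@exists_john1 R dual 70 (1 / 4) (1 / 2) dual_gt0 continuous_dual
  dual_quasiconcave _ dual_tail).
- by apply/andP; split; lra.
- apply: lb; rewrite theta_neg; last by lra.
  by move: b c0 c1 => c *; nra.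
- apply: lb; rewrite theta_pos; last by lra.
  by move: b c0 c1 => c *; nra.
Qed.

(* The interval of the polar Loewner function is [b - slope, b + slope], with
   height exp(-1/2); the new product of length and height is larger because
   83/80 * (1 - 1/28) > 1. *)
Lemma dual_longer_interval (u : R) :
  b + - ((21 / 20) * slope) <= u <= b + (41 / 40) * slope ->
  expR (- (1 / 2 + 1 / 28)) <= dual u.
Proof.
move=> /andP[h1 h2]; have s0 := @slope_gt0 R; have s2 := @sqr_slope R.
have sb := @slope_center R.
rewrite /dual ler_expR lerN2.
have : - ((21 / 20) * slope) <= u - b <= (41 / 40) * slope.
  by apply/andP; split; lra.
move/theta_quasiconvex; rewrite le_max => /orP[|] /le_trans; apply.
  rewrite theta_neg; last by lra.
  by move: slope b s0 s2 sb h1 h2 => s c *; nra.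
rewrite theta_pos; last by lra.
by move: slope b s0 s2 sb h1 h2 => s c *; nra.
Qed.

(** [theta] equals 1/2 at both [slope] and [- slope], where its outward derivatives times [slope]
    are 13/10 and 7/10. As 10/13 + 10/7 > 2, lowering the height gains more in length than it
    loses. *)
Lemma john_dual_neq j : is_john (fun x : V => dual (x 0 0)) j ->
  polar_loewner_ex <> j.
Proof.
move=> [s [T [a [opt jE]]]]; rewrite {}jE => /funeqP E.
have s0 := @slope_gt0 R.
have inE' (y : V) : `|y 0 0 - b| <= slope ->
    polar_loewner_ex y = expR (- (1 / 2)).
  move=> hy; rewrite /polar_loewner_ex -/slope indicE mem_set ?mulr1//=.
  by move: hy; rewrite ler_norml => /andP[h1 h2]; apply/andP; split; lra.
have notin (y : V) : slope < `|y 0 0 - b| -> polar_loewner_ex y = 0.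
  move=> hy; rewrite /polar_loewner_ex -/slope indicE memNset ?mulr0//= => /andP[h1 h2].
  by move: hy; rewrite ltNge => /negP; apply; rewrite ler_norml; apply/andP; split; lra.
have bE : (b%:M : V) 0 0 = b by rewrite mxE eqxx mulr1n.
have sE : s = expR (- (1 / 2)).
  have := E b%:M; rewrite inE' ?bE ?subrr ?normr0 ?ltW// /ball_fun indicE.
  by case: (_ \in _); rewrite ?mulr1 ?mulr0// => /eqP; rewrite expR_eq0.
have inI (u : V) : norm2 u <= 1 -> `|aff T a u 0 0 - b| <= slope.
  move=> u1; rewrite leNgt; apply/negP => /notin; rewrite E ball_fun_in// sE.
  by move/eqP; rewrite expR_eq0.
have Ts : `|T 0 0| <= slope.
  have := @norm2_row_le R 1 T a 0 b slope inI.
  by rewrite norm2_1 !mxE.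
have l'0 : 0 < (83 / 80) * slope by lra.
(* The interval from b - (21/20) [slope] to b + (41/40) [slope] has half-length (83/80) [slope] and
   center b - (1/80) [slope]. *)
have := john_optimal1_le dual_gt0 l'0 opt (s' := expR (- (1 / 2 + 1 / 28)))
  (a' := b - (1 / 80) * slope) _.
have h u : b - 1 / 80 * slope - 83 / 80 * slope <= u <=
    b - 1 / 80 * slope + 83 / 80 * slope ->
    expR (- (1 / 2 + 1 / 28)) <= dual u.
  by move=> /andP[h1 h2]; apply: dual_longer_interval; apply/andP; split; lra.
move=> /(_ h); rewrite sE opprD expRD -[leLHS]mulrA ler_pM2l ?expR_gt0//.
have := expR_ge1Dx (- (1 / 28) : R) => h1 h2.
have := ler_wpM2r (ltW l'0) h1; lra.
Qed.

End Dual.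

(** * The Loewner function of the polar, and the John function of the example with its polar *)

Section DualLoewner.
Context {R : realType}.
Notation V := 'cV[R]_1.
Notation b := (@center_ex R).

(* The critical point of t - ln tau under 2 t = 5 tau^2 - 6 b tau + 5 b^2. *)
Lemma exists_dual_slope : exists2 tau : R, 0 < tau & 5 * tau ^+ 2 = 1 + 3 * b * tau.
Proof.
have c0 := @center_ex_gt0 R; set d := 9 * b ^+ 2 + 20.
have d0 : 0 <= d by rewrite addr_ge0// mulr_ge0// sqr_ge0.
exists ((3 * b + Num.sqrt d) / 10).
  by rewrite divr_gt0// ltr_wpDr ?sqrtr_ge0// mulr_gt0.
have := sqr_sqrtr d0; rewrite {2}/d; move: (Num.sqrt d) b => r c r2; lra.
Qed.

(** The constants make the cone tangent to [theta] at w = 2 (tau + b) and w = -8 (tau - b); the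
    latter lies on the negative branch because b <= tau. *)
Lemma dual_cone_bound (tau w : R) : b <= tau ->
  `|tau * w - ((tau + b) ^+ 2 - 4 * (tau - b) ^+ 2) / 2| <=
  theta w + (5 * tau ^+ 2 - 6 * b * tau + 5 * b ^+ 2) / 2.
Proof.
move=> bt; have c0 := @center_ex_gt0 R; move: b c0 bt (@theta_pos R w) (@theta_neg R w) => c c0 ct tp tn.
have p1 := sqr_ge0 (tau + c); have p2 := sqr_ge0 (tau - c).
have [w0|/ltW w0] := leP w 0.
  have s1 := sqr_ge0 (w / 4 + 2 * (tau - c)); have s2 := sqr_ge0 w.
  have s3 : (c + tau) * w <= 0 by rewrite mulr_ge0_le0// addr_ge0 ?(le_trans _ ct)// ltW.
  by rewrite tn// ler_norml; apply/andP; split; lra.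
have s1 := sqr_ge0 (w / 2 - (tau + c)); have s2 := sqr_ge0 w.
have s3 : 0 <= (tau - c) * w by rewrite mulr_ge0// subr_ge0.
by rewrite tp// ler_norml; apply/andP; split; lra.
Qed.

Lemma exists_loewner_dual :
  exists h c, is_loewner (fun x : V => dual (x 0 0)) h c.
Proof.
have [tau tau0 tauE] := exists_dual_slope.
have c0 := @center_ex_gt0 R; have c2 := @sqr_center_ex R.
pose t := (5 * tau ^+ 2 - 6 * b * tau + 5 * b ^+ 2) / 2.
pose beta := ((tau + b) ^+ 2 - 4 * (tau - b) ^+ 2) / 2.
have tau2b : 2 * b <= tau.
  rewrite leNgt; apply/negP => h; move: b c0 c2 tauE h => c c0 c2 tauE h; nra.
exists (cone_fun tau%:M (- (tau * b) - beta)%:M t), (- ((- (tau * b) - beta) / tau))%:M.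
apply: (@is_loewner1 R (fun u => theta (u - b))) => //.
  move=> u; rewrite (_ : tau * u + _ = tau * (u - b) - beta); last by ring.
  by apply: dual_cone_bound; lra.
move=> tau' alpha t' tau'0 h.
pose D := tau' * b + alpha.
have {}h w : `|D + tau' * w| <= theta w + t'.
  have := h (w + b); rewrite addrK (_ : _ + alpha = D + tau' * w)//.
  by rewrite /D; ring.
clearbody D.
have h1 : D + (tau' + b) ^+ 2 <= t'.
  have := h (2 * (tau' + b)); rewrite theta_pos; last by lra.
  by rewrite ler_norml => /andP[_]; lra.
have [bt|bt] := leP b tau'.
  have h2 : - D + 4 * (tau' - b) ^+ 2 <= t'.
    have := h (- 8 * (tau' - b)); rewrite theta_neg; last by lra.
    by rewrite ler_norml => /andP[+ _]; lra.
  apply: expR_div_le_tangent => //.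
  rewrite ler_pdivrMr//.
  have h3 : 5 * tau' ^+ 2 - 6 * b * tau' + 5 * b ^+ 2 <= 2 * t' by lra.
  have h4 : (5 * tau' ^+ 2 - 6 * b * tau' + 5 * b ^+ 2) * tau <= 2 * t' * tau.
    by rewrite ler_pM2r.
  have h5 : 0 <= (tau' - tau) ^+ 2 * tau by rewrite mulr_ge0 ?sqr_ge0// ltW.
  have h6 : 5 * tau ^+ 2 * (tau' - tau) = (1 + 3 * b * tau) * (tau' - tau) by rewrite tauE.
  by rewrite /t; move: b h4 h5 h6 => c h4 h5 h6; lra.
(* For tau' < b the second tangency point moves to the positive branch. Such flat cones lose
   crudely: e^t / tau <= 2 / (2 b) = 1/b, while t' >= 0 gives e^t' / tau' >= 1/b. *)
have h2 : - D + (b - tau') ^+ 2 <= t'.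
  have := h (2 * (b - tau')); rewrite theta_pos; last by lra.
  by rewrite ler_norml => /andP[+ _]; lra.
have t'0 : 0 <= t' by have := sqr_ge0 (tau' + b); have := sqr_ge0 (b - tau'); lra.
have tle : t <= 1 / 2.
  by rewrite /t; move: b c0 c2 tauE tau2b => c *; nra.
have et : expR t <= 2.
  apply: (@le_trans _ _ (expR (1 / 2))); first by rewrite ler_expR.
  rewrite -[1 / 2]opprK expRN invf_ple ?posrE ?expR_gt0//.
  by apply: le_trans (expR_ge1Dx _); lra.
apply: (@le_trans _ _ b^-1).
  rewrite ler_pdivrMr// ler_pdivlMl//; apply: le_trans tau2b.
  by rewrite mulrC ler_pM2r.
apply: (@le_trans _ _ tau'^-1); first by rewrite lef_pV2 ?posrE// ltW.
by rewrite ler_peMl ?invr_ge0 ?(ltW tau'0)// -expR0 ler_expR.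
Qed.

Notation hs := (Num.sqrt (1 / 2) : R).

Lemma hs_gt0 : 0 < hs. Proof. by rewrite sqrtr_gt0; lra. Qed.
Lemma sqr_hs : hs ^+ 2 = 1 / 2. Proof. by rewrite sqr_sqrtr//; lra. Qed.

(** The level set of [psi_ex] at c^2 is [-c/2, c], of half-length 3c/4; an interval of half-length l
    therefore leaves, or just fills, the level c = 4l/3. *)
Lemma f_ex_height (s l a : R) : 0 < l -> s <= expR (- psi_ex (a - l)) ->
  s <= expR (- psi_ex (a + l)) -> s <= expR (- (4 / 3 * l) ^+ 2).
Proof.
move=> l0 h1 h2; have [c|c] := leP (4 / 3 * l) (a + l).
  apply: le_trans h2 _; rewrite ler_expR lerN2 psi_ex_pos; last by lra.
  by rewrite ler_pXn2r// ?nnegrE; lra.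
apply: le_trans h1 _; rewrite ler_expR lerN2 psi_ex_neg; last by lra.
rewrite (_ : 4 * _ = (2 * (l - a)) ^+ 2); last by ring.
by rewrite ler_pXn2r// ?nnegrE; lra.
Qed.

(** u exp(-u^2) is largest at u = sqrt(1/2). The additional square measures the deficit, and it is
    what gives uniqueness of J(f). *)
Lemma mul_expRN_sqr_le (u : R) :
  expR (- u ^+ 2) * (u + hs * (u - hs) ^+ 2) <= expR (- (1 / 2)) * hs.
Proof.
have s0 := hs_gt0; have s2 := sqr_hs.
rewrite (_ : - (1 / 2) = - u ^+ 2 + (u ^+ 2 - 1 / 2)); last by ring.
rewrite expRD -mulrA ler_pM2l ?expR_gt0//.
apply: le_trans (_ : (1 + (u ^+ 2 - 1 / 2)) * hs <= _); last first.
  by rewrite ler_pM2r// expR_ge1Dx.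
have h : hs ^+ 2 * u = 1 / 2 * u by rewrite s2.
have h' : hs ^+ 2 * hs = 1 / 2 * hs by rewrite s2.
by move: hs h h' => r h h'; lra.
Qed.

Lemma john_f_ex_optimal :
  john_optimal f_ex (expR (- (1 / 2))) (3 / 4 * hs)%:M ((hs / 4)%:M : V).
Proof.
have s0 := hs_gt0; have s2 := sqr_hs.
apply: (@is_john1 R (fun u => expR (- psi_ex u))).
- by move=> u; exact: expR_gt0.
- exact: expR_ge0.
- by rewrite mulr_gt0.
- move=> u /andP[h1 h2]; rewrite ler_expR lerN2 -s2.
  have [u0|/ltW u0] := leP u 0.
    rewrite psi_ex_neg// (_ : 4 * _ = (- 2 * u) ^+ 2); last by ring.
    by rewrite ler_pXn2r// ?nnegrE; lra.
  by rewrite psi_ex_pos// ler_pXn2r// ?nnegrE; lra.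
- move=> s l a s'0 l0 h1 h2; have h3 := f_ex_height l0 h1 h2.
  have h4 := mul_expRN_sqr_le (4 / 3 * l).
  have h5 : 0 <= expR (- (4 / 3 * l) ^+ 2) * (hs * (4 / 3 * l - hs) ^+ 2).
    by rewrite mulr_ge0 ?expR_ge0// mulr_ge0 ?sqr_ge0// ltW.
  have := ler_wpM2r (ltW l0) h3.
  by move: (expR (- (4 / 3 * l) ^+ 2)) h4 h5 => E h4 h5; lra.
Qed.

Lemma john_f_ex_unique (s : R) T (a : V) : john_optimal f_ex s T a ->
  [/\ s = expR (- (1 / 2)), a 0 0 = hs / 4 & `|T 0 0| = 3 / 4 * hs].
Proof.
move=> opt; have s0 := hs_gt0; have s2 := sqr_hs.
have [[uT _ _] _] := opt.
have T0 : 0 < `|T 0 0| by rewrite normr_gt0 -unitmx1.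
have [h1 h2] := john_endpoints (phi := fun u => expR (- psi_ex u))
  (john_feasible_ball opt.1).
have le0 := opt.2 _ _ _ john_f_ex_optimal.1.
rewrite !det_mx11 mxE eqxx mulr1n ger0_norm in le0; last by rewrite mulr_ge0// ltW.
have h3 := f_ex_height T0 h1 h2.
have h4 := mul_expRN_sqr_le (4 / 3 * `|T 0 0|).
have h6 := ler_wpM2r (ltW T0) h3.
have TE : 4 / 3 * `|T 0 0| = hs.
  have E0 := expR_gt0 (- (4 / 3 * `|T 0 0|) ^+ 2 : R).
  have : expR (- (4 / 3 * `|T 0 0|) ^+ 2) * (hs * (4 / 3 * `|T 0 0| - hs) ^+ 2) <= 0.
    by move: (expR (- (4 / 3 * _) ^+ 2)) h4 h6 => E h4 h6; lra.
  rewrite pmulr_rle0// pmulr_rle0// => q.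
  by apply/eqP; rewrite -subr_eq0 -sqrf_eq0 eq_le q sqr_ge0.
have TE' : `|T 0 0| = 3 / 4 * hs by lra.
have sE : s = expR (- (1 / 2)).
  apply/eqP; rewrite eq_le; apply/andP; split.
    by apply: le_trans h3 _; rewrite TE s2.
  by rewrite -(ler_pM2r T0) {1}TE'.
(* The half-length and the height leave no room: a larger center pushes the right end, a smaller one
   the left end, out of the level set. *)
split=> //; move: h1 h2; rewrite sE TE' !ler_expR !lerN2.
move: (a 0 0) => c h1 h2; apply/eqP; rewrite eq_le; apply/andP; split.
  rewrite leNgt; apply/negP => hc; move: h2; rewrite psi_ex_pos; last by lra.
  by move: hs s0 s2 hc => r *; nra.
rewrite leNgt; apply/negP => hc; move: h1; rewrite psi_ex_neg; last by lra.
by move: hs s0 s2 hc => r *; nra.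
Qed.

Lemma polar_ball1 (s l a : R) (T : 'M[R]_1) (z A w : V) : 0 < s -> A 0 0 = a ->
  `|T 0 0| = l ->
  polar z (ball_fun s T A) w =
  expR (- ((a - z 0 0) * (w 0 0 - z 0 0) + l * `|w 0 0 - z 0 0| + ln s)).
Proof.
move=> s0 aE lE; have l0 : 0 <= l by rewrite -lE.
rewrite ball_funE//; set S := fun _ => _.
set d := w 0 0 - z 0 0.
have dE (v : R) : dot ((v%:M : V) - z) (w - z) - - ln s = (v - z 0 0) * d + ln s.
  by rewrite dot1 !mxE eqxx mulr1n opprK.
pose v := a + l * Num.sg d.
have ld : (v - z 0 0) * d + ln s = (a - z 0 0) * d + l * `|d| + ln s.
  by rewrite /v (normrEsg d); ring.
rewrite -ld -dE; apply: polar_trunc_exp => [|x /asboolP/ball1_interval].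
  apply/asboolP/ball1_interval; rewrite aE lE mxE eqxx mulr1n /v.
  have : `|l * Num.sg d| <= l.
    by rewrite normrM (ger0_norm l0) ler_piMr// normr_sg; case: (_ != _).
  by rewrite ler_norml => /andP[h1 h2]; apply/andP; split; lra.
rewrite aE lE => /andP[h1 h2].
rewrite dE ld dot1 !mxE -/d opprK lerD2r.
have h : `|x 0 0 - a| <= l by rewrite ler_norml; apply/andP; split; lra.
have : (x 0 0 - a) * d <= l * `|d|.
  apply: le_trans (ler_norm _) _; rewrite normrM; exact: ler_wpM2r.
by move: (x 0 0) (z 0 0) `|d| => X Z N; lra.
Qed.

(* A cone has equal slopes on both sides of its apex, so its apex is the point of
   polarity and that point is the midpoint of the interval. *)
Lemma polar_ball1_eq_cone (s l a t : R) (T T' : 'M[R]_1) (z A a' : V) : 0 < s ->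
  A 0 0 = a -> `|T 0 0| = l -> 0 < l ->
  cone_fun T' a' t = polar z (ball_fun s T A) -> a = z 0 0.
Proof.
move=> s0 aE lE l0 /funeqP E.
pose D := T' 0 0 * z 0 0 + a' 0 0.
have {}E w : `|D + T' 0 0 * w| = t + ln s + (a - z 0 0) * w + l * `|w|.
  have := E (z 0 0 + w)%:M; rewrite cone_fun1 (polar_ball1 _ _ s0 aE lE).
  rewrite mxE eqxx mulr1n (addrC (z 0 0)) addrK => /expR_inj.
  by rewrite (_ : T' 0 0 * _ + _ = D + T' 0 0 * w); [lra|rewrite /D; ring].
clearbody D; move: (T' 0 0) (t + ln s) E => u k E.
(* After squaring, the right side contains 2 l (a - z) w |w|, which a quadratic polynomial cannot
   match; the values at 0, 1, -1, 2 and -2 already force l (a - z) = 0. *)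
have sq w : (D + u * w) ^+ 2 = (k + (a - z 0 0) * w + l * `|w|) ^+ 2.
  by rewrite -E real_normK ?num_real.
have := sq 0; have := sq 1; have := sq (-1); have := sq 2; have := sq (-2).
rewrite !normrN !normr1 normr0 (ger0_norm (_ : 0 <= 2))//.
move: (z 0 0) => c q1 q2 q3 q4 q5; apply/eqP; rewrite -subr_eq0.
have : l * (a - c) = 0 by lra.
by move/eqP; rewrite mulf_eq0 gt_eqF.
Qed.

(** Equality would put b at the center sqrt(1/2) / 4 of J(f), but b^2 = 9/320 while that center has
    square 10/320. *)
Lemma loewner_dual_neq h c j : is_loewner (fun x : V => dual (x 0 0)) h c ->
  is_john f_ex j -> h <> polar b%:M j.
Proof.
move=> [T' [a' [t [_ _ hE _]]]] [s [T [a [/john_f_ex_unique[sE aE TE] jE]]]].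
rewrite {}hE {}jE => /(polar_ball1_eq_cone _ aE TE).
rewrite sE expR_gt0 mulr_gt0 ?hs_gt0// mxE eqxx mulr1n => /(_ isT isT) E.
have := @sqr_center_ex R; rewrite -E; have := sqr_hs; lra.
Qed.

End DualLoewner.

Theorem mainTheorem5 (R : realType) :
  (* in every dimension n >= 1, (L f)^b = J(f^b) fails for some f, *)
  (forall n : nat, (0 < n)%N ->
    exists f g j : 'cV[R]_n -> R, exists b : 'cV[R]_n,
      [/\ admissible f, is_loewner f g b, is_john (polar b f) j
        & polar b g <> j]) /\
  (* and L(f^b) = (J f)^b fails for some f; *)
  (forall n : nat, (0 < n)%N ->
    exists f g h j : 'cV[R]_n -> R, exists b b' : 'cV[R]_n,
      [/\ admissible f, is_loewner f g b, is_loewner (polar b f) h b',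
          is_john f j & h <> polar b j]) /\
  (* the one-dimensional example *)
  (let f := @f_ex R in
   let b : 'cV[R]_1 := center_ex%:M in
   [/\ admissible f,
       (forall g c, is_loewner f g c <-> g = loewner_ex /\ c = b),
       polar b loewner_ex = polar_loewner_ex,
       (exists j, is_john (polar b f) j) /\
         (forall j, is_john (polar b f) j -> polar b loewner_ex <> j)
     & (exists h c, is_loewner (polar b f) h c) /\ (exists j, is_john f j) /\
         (forall h c j, is_loewner (polar b f) h c -> is_john f j ->
            h <> polar b j)]).
Proof.
split; [|split].
- case=> // m _; exists radial_ex, (cone_fun (diag_mx (axial 1 1)) (vcons 0 0) 0),
    (ball_fun 1 (diag_mx (axial 2 1)) (vcons 1 0)), 0; split.
  + exact: admissible_radial_ex.
  + exact: loewner_radial_ex.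
  + exact: john_polar_radial_ex.
  + exact: polar_loewner_radial_ex.
- case=> // m _; have [b' b'P] := @loewner_polar_cyl_ex R m.
  exists cyl_ex, (cone_fun (diag_mx (axial 1 m%:R)) (vcons 0 0) m%:R),
    (cone_fun (diag_mx (axial (1 / 2) 1)) (vcons (- (1 / 2)) 0) 1), john_cyl_ex, 0, b'.
  split=> //.
  + exact: admissible_cyl_ex.
  + exact: loewner_cyl_ex.
  + exact: is_john_cyl_ex.
  + exact: loewner_polar_cyl_ex_neq.
- move=> f b; rewrite /f /b polar_f_ex polar_loewner_exE; split=> //.
  + exact: admissible_ex.
  + move=> g c; split; first exact: is_loewner_ex_unique.
    by move=> [-> ->]; exact: is_loewner_ex.
  + split; last exact: john_dual_neq.
    have [s [l [a [_ opt]]]] := @exists_john_dual R.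
    by exists (ball_fun s l%:M a%:M), s, l%:M, a%:M.
  + split; first exact: exists_loewner_dual.
    split; last exact: loewner_dual_neq.
    by do 4 eexists; split; [exact: john_f_ex_optimal|].
Qed.
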